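(* For each $n>1$ and each $k>2$ (integers), let $X_k^n=\{(z_1,\dots,z_n,w)\in\mathbb{C}^{n+1} : z_1^2+\dots+z_n^2-w^k=0\}$, considered as a germ at the origin $\mathbf{0}$ and equipped with its inner metric. Then the hypersurface $X_k^n$ admits a choking horn, namely its real part $$X_k^n\cap(\mathbb{R}\times 0)^{n+1}=\{(x_1,\dots,x_n,y)\in\mathbb{R}^{n+1} : x_1^2+\dots+x_n^2-y^k=0\},$$ where $\mathbb{R}^{n+1}=(\mathbb{R}\times 0)^{n+1}\subset\mathbb{C}^{n+1}$ is the usual embedding.
   Context: Outer and inner metrics: on a subset $X$ of a Euclidean space, the outer metric is the restriction of the Euclidean distance; the inner metric is the one for which the distance between two points is the infimum of the lengths of rectifiable curves in $X$ joining them. Here $\mathbb{C}=\mathbb{R}\times\mathbb{R}$, and $\mathbb{C}^{n+1}$ is identified with $\mathbb{R}^{2n+2}$. For a germ $Z$ at the origin of a subset of a Euclidean space, the $t$-link $Z_t$ is the set of points of $Z$ whose Euclidean distance to the origin equals $t$. Horn: let $(X,\mathbf{0})$ be the germ of a connected subanalytic subset of a Euclidean space, equipped with a metric $d$ which is either the outer or the inner metric. A horn in $X$ is the image of a subanalytic continuous map $\phi:[0,1]\times\mathbf{S}^p\to X$, where $\mathbf{S}^p$ is the real unit sphere of positive dimension $p$, such that (1) $\phi(t,u)\in X_t$ for every $(t,u)\in[0,1]\times\mathbf{S}^p$, and (2) the tangent cone at $\mathbf{0}$ of the image of $\phi$ is a single real half-line. Choking horn: a horn $Y$ in $(X,d)$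 is said to choke $X$, and is called a choking horn, if there is a real number $K>0$, independent of $t$, such that for every sufficiently small $t$ and every chain $\xi_t$ with support $\mathrm{supp}(\xi_t)\subset X_t$ and $\partial\xi_t=Y_t$, the $d$-diameter satisfies $\mathrm{diam}(\mathrm{supp}(\xi_t))\ge Kt$. Here $Y_t$, the $t$-link of $Y$, is regarded as a cycle.
   Formalization: For even k the real part is not a horn (its tangent cone is a full line and its t-link is two disjoint spheres); the formal statement says instead that each half of the real part, y ≥ 0 and y ≤ 0, is a choking horn. For odd k the real part itself is shown to be a choking horn. *)

(* Defs.v *)
From HB Require Import structures.
From mathcomp Require Import all_boot all_order all_algebra.
From mathcomp Require Import all_classical all_reals all_analysis.
From mathcomp Require Import complex freeg.

Set Implicit Arguments.
Unset Strict Implicit.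
Unset Printing Implicit Defensive.

Import Order.TTheory GRing.Theory Num.Theory.
Import numFieldNormedType.Exports.

Local Open Scope classical_set_scope.
Local Open Scope ring_scope.

Section Euclidean.
Variable R : realType.

(* The library norm of 'rV[R]_N is the sup norm; it induces the same topology
   as the Euclidean norm, but not the same links, lengths and diameters. *)
Definition enorm N (x : 'rV[R]_N) : R := Num.sqrt (\sum_(i < N) x 0 i ^+ 2).

Definition sphere p : set 'rV[R]_p.+1 := [set u | enorm u = 1].

Definition link N (Z : set 'rV[R]_N) (t : R) : set 'rV[R]_N :=
  Z `&` [set x | enorm x = t].

Definition germ_eq N (A B : set 'rV[R]_N) : Prop :=
  \forall x \near (0 : 'rV[R]_N), A x <-> B x.

Definition tangent_cone0 N (A : set 'rV[R]_N) : set 'rV[R]_N :=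
  [set v | exists (x : nat -> 'rV[R]_N) (r : nat -> R),
    [/\ forall m, A (x m), forall m, 0 < r m,
        x @ \oo --> (0 : 'rV[R]_N) & (fun m => r m *: x m) @ \oo --> v]].

Definition half_line N (A : set 'rV[R]_N) : Prop :=
  exists2 v : 'rV[R]_N, v != 0 & A = [set s *: v | s in [set s : R | 0 <= s]].

Definition curve_length N (g : R -> 'rV[R]_N) : \bar R :=
  ereal_sup [set (\sum_(0 <= i < size s)
                    enorm (g (nth 1 (0 :: s) i.+1) - g (nth 1 (0 :: s) i)))%:E
            | s in itv_partition 0 1].

Definition curve_in N (X : set 'rV[R]_N) (x y : 'rV[R]_N) (g : R -> 'rV[R]_N) :=
  [/\ {within `[0, 1], continuous g}, g @` `[0, 1] `<=` X, g 0 = x & g 1 = y].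

Definition inner_dist N (X : set 'rV[R]_N) (x y : 'rV[R]_N) : \bar R :=
  ereal_inf [set curve_length g
            | g in [set g | curve_in X x y g /\ (curve_length g < +oo)%E]].

Definition diam N (d : 'rV[R]_N -> 'rV[R]_N -> \bar R) (A : set 'rV[R]_N) :=
  ereal_sup [set d x y | x in A & y in A].

End Euclidean.

Section Subanalytic.
Variable R : realType.

(* Expansion in a power series on the polydisc of radius r around a.  The bound
   on the coefficients makes the series absolutely convergent there, so summing
   over the boxes [0, K)^m loses no generality. *)
Definition analytic_at m (f : 'rV[R]_m -> R) (a : 'rV[R]_m) : Prop :=
  exists (c : {ffun 'I_m -> nat} -> R) (M r : R),
    [/\ 0 < r,
        forall e, `|c e| * r ^+ (\sum_(i < m) e i) <= M &
        forall x : 'rV[R]_m, (forall i, `|x 0 i - a 0 i| < r) ->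
          (fun K : nat => \sum_(e : {ffun 'I_m -> 'I_K})
             c [ffun i => e i : nat] * \prod_(i < m) (x 0 i - a 0 i) ^+ e i)
          @ \oo --> f x].

Definition semianalytic m (A : set 'rV[R]_m) : Prop :=
  forall a : 'rV[R]_m, exists2 U : set 'rV[R]_m, open_nbhs a U &
    exists (I J : nat) (f : 'I_I -> 'I_J -> 'rV[R]_m -> R)
           (is_eq : 'I_I -> 'I_J -> bool),
      (forall i j x, U x -> analytic_at (f i j) x) /\
      (forall x, U x -> (A x <-> exists i, forall j,
         if is_eq i j then f i j x = 0 else 0 < f i j x)).

Definition subanalytic m (A : set 'rV[R]_m) : Prop :=
  forall a : 'rV[R]_m, exists2 U : set 'rV[R]_m, open_nbhs a U &
    exists (q : nat) (B : set 'rV[R]_(m + q)),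
      [/\ semianalytic B, compact (closure B) & A `&` U = lsubmx @` B].

End Subanalytic.

(* Singular homology with integer coefficients. *)
Section Singular.
Variable R : realType.

Definition std_simplex q : set 'rV[R]_q.+1 :=
  [set x | (forall i, 0 <= x 0 i) /\ \sum_(i < q.+1) x 0 i = 1].

(* Maps on the standard simplex are represented by functions on the ambient
   space vanishing off the simplex, so that equal simplices are equal
   generators of the free abelian group of chains. *)
Definition normalize N q (s : 'rV[R]_q.+1 -> 'rV[R]_N) : 'rV[R]_q.+1 -> 'rV[R]_N :=
  patch (fun=> 0) (@std_simplex q) s.

Definition singular_simplex N q (X : set 'rV[R]_N)
    (s : 'rV[R]_q.+1 -> 'rV[R]_N) : Prop :=
  [/\ {within @std_simplex q, continuous s},
      s @` @std_simplex q `<=` X & normalize s = s].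

Definition chain N q := {freeg ('rV[R]_q.+1 -> 'rV[R]_N) / int}.

Definition chain_in N q (X : set 'rV[R]_N) (c : chain N q) : Prop :=
  forall s, s \in dom c -> singular_simplex X s.

Definition supp N q (c : chain N q) : set 'rV[R]_N :=
  \bigcup_(s in [set s | s \in dom c]) (s @` @std_simplex q).

Definition coface q (i : 'I_q.+2) (x : 'rV[R]_q.+1) : 'rV[R]_q.+2 :=
  \row_(j < q.+2) oapp (x 0) 0 (unlift i j).

Definition face N q (i : 'I_q.+2) (s : 'rV[R]_q.+2 -> 'rV[R]_N) :
    'rV[R]_q.+1 -> 'rV[R]_N :=
  normalize (s \o coface i).

Definition boundary N q (c : chain N q.+1) : chain N q :=
  fglift (fun s => \sum_(i < q.+2) (-1) ^+ i *: << face i s >> : chain N q) c.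

Definition chain_map M N q (f : 'rV[R]_M -> 'rV[R]_N) (c : chain M q) :
    chain N q :=
  fglift (fun s => << normalize (f \o s) >> : chain N q) c.

Definition cycle_in N q (X : set 'rV[R]_N) (z : chain N q.+1) : Prop :=
  chain_in X z /\ boundary z = 0.

(* z represents a generator of H_{p+1}(S^{p+1}; Z). *)
Definition fundamental_cycle p (z : chain p.+2 p.+1) : Prop :=
  cycle_in (@sphere R p.+1) z /\
  forall z' : chain p.+2 p.+1, cycle_in (@sphere R p.+1) z' ->
    exists (m : int) (b : chain p.+2 p.+2),
      chain_in (@sphere R p.+1) b /\ z' - m *: z = boundary b.

End Singular.

Section ChokingHorns.
Variables (R : realType) (N : nat).
Implicit Types X Y : set 'rV[R]_N.

Definition cylinder p : set (R * 'rV[R]_p.+1) := `[0, 1] `*` @sphere R p.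

Definition graph p (phi : R * 'rV[R]_p.+1 -> 'rV[R]_N) :
    set 'rV[R]_(1 + (p.+1 + N)) :=
  [set row_mx tu.1%:M (row_mx tu.2 (phi tu)) | tu in @cylinder p].

(* The sphere has dimension p.+1, hence positive dimension. *)
Record horn_map X p (phi : R * 'rV[R]_p.+2 -> 'rV[R]_N) : Prop := HornMap {
  horn_continuous : {within @cylinder p.+1, continuous phi} ;
  horn_subanalytic : subanalytic (graph phi) ;
  horn_link : forall tu, @cylinder p.+1 tu -> link X tu.1 (phi tu) ;
  horn_cone : half_line (tangent_cone0 (phi @` @cylinder p.+1)) }.

(* The t-link of the horn is the image of phi (t, -); as a cycle, it is the
   image of the fundamental class of the sphere. *)
Definition chokes X (d : 'rV[R]_N -> 'rV[R]_N -> \bar R)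
    p (phi : R * 'rV[R]_p.+2 -> 'rV[R]_N) : Prop :=
  exists2 K : R, 0 < K & \forall t \near (0 : R)^'+,
    forall (z : chain R p.+2 p.+1) (xi : chain R N p.+2),
      fundamental_cycle z -> chain_in (link X t) xi ->
      boundary xi = chain_map (fun u => phi (t, u)) z ->
      ((K * t)%:E <= diam d (supp xi))%E.

(* Y is considered up to equality of germs at the origin. *)
Definition choking_horn X (d : 'rV[R]_N -> 'rV[R]_N -> \bar R) Y : Prop :=
  [/\ connected X, subanalytic X &
      exists (p : nat) (phi : R * 'rV[R]_p.+2 -> 'rV[R]_N),
        [/\ horn_map X phi, germ_eq (phi @` @cylinder p.+1) Y & chokes X d phi]].

End ChokingHorns.

Section Hypersurface.
Variables (R : realType) (n : nat).

(* C^{n+1} = (R * R)^{n+1} is the space of (n+1) x 2 matrices, flattened by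
   mxvec; coordinates 0, ..., n-1 are z_1, ..., z_n and the last one is w. *)
Definition ccoord (v : 'rV[R]_(n.+1 * 2)) (j : 'I_n.+1) : R[i] :=
  Complex (vec_mx v j 0) (vec_mx v j 1).

Definition hypersurface (k : nat) : set 'rV[R]_(n.+1 * 2) :=
  [set v | \sum_(i < n) ccoord v (widen_ord (leqnSn n) i) ^+ 2
           - ccoord v ord_max ^+ k = 0].

Definition real_points : set 'rV[R]_(n.+1 * 2) :=
  [set v | forall j, vec_mx v j 1 = 0].

Definition real_embedding (x : 'rV[R]_n.+1) : 'rV[R]_(n.+1 * 2) :=
  mxvec (\matrix_(j < n.+1, l < 2) if l == 0 then x 0 j else 0).

Definition real_hypersurface (k : nat) : set 'rV[R]_n.+1 :=
  [set x | \sum_(i < n) x 0 (widen_ord (leqnSn n) i) ^+ 2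
           - x 0 ord_max ^+ k = 0].

(* The last real coordinate, called y on real points. *)
Definition re_w (v : 'rV[R]_(n.+1 * 2)) : R := vec_mx v ord_max 0.

End Hypersurface.

(* Main.v *)
Require Import Defs.
From mathcomp Require Import all_boot all_order all_algebra.
From mathcomp Require Import all_classical all_reals all_analysis.
From mathcomp Require Import complex freeg ring lra.
Import Order.TTheory GRing.Theory Num.Theory.
Import numFieldNormedType.Exports.
Local Open Scope classical_set_scope.
Local Open Scope ring_scope.

(** Write v = (z, w) for a point of C^n x C, and let y be the real value of w
    on the real part.  The t-link of the real part is a round sphere S^(n-1)
    of radius y^(k/2), placed at a height y comparable to t.  Suppose that a
    chain of the t-link of the hypersurface bounds this sphere and has inner
    diameter less than t / 4.  Inner distances dominate Euclidean ones, so on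
    the whole support w stays in the half-plane where Re w has the sign of y.
    There sg * w has a continuous square root, hence w^k has a continuous
    nowhere vanishing square root g, and the equation reads
    sum (z_j / g)^2 = 1.  Its real part says |Re (z / g)| >= 1: up to the
    positive factor |g|^2 the vector Re (z * conj g) never vanishes, so that
    this part of the hypersurface maps to R^n minus the origin, and the real
    sphere is sent there by a homothety (choke_map_neq0, choke_map_horn).  The chain would
    thus make the fundamental cycle of S^(n-1) a boundary, which
    radial_obstruction forbids.

    That the fundamental cycle of S^(n-1) does not bound is proved by counting
    labels in the manner of Sperner.  The punctured space is covered by n + 1
    open half-spaces with empty intersection, and a nonzero point is labelled
    by one of them that contains it.  The winding number of a chain at level N
    is the signed number of cells, in the N-th barycentric subdivision of its
    simplices, whose vertices carry all labels but the first.  On a boundary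
    it counts the cells of one dimension higher that carry all labels, and
    there are none once the subdivision is fine, by compactness
    (winding_number_boundary0).  On the boundary of a large simplex around the
    origin it is 1 at every level, by the oriented Sperner lemma
    (sperner_count).  Every cycle being a multiple of the fundamental one up
    to a boundary, the latter cannot bound.  Subdivision acts here on
    functions of finite sequences of points rather than on singular chains,
    so that all that is needed of it is that it commutes with the coboundary
    (sd_delta) and that it shrinks cells (sd_support).

    The horn is parametrised by phi (t, u) = (c^k u, sg c^2), where c is the
    nonnegative root of c^4 + c^(2k) = t^2 and sg = 1 or -1 selects one of the
    two half-horns when k is even.  Its tangent cone is a half-line because
    k > 2 makes the radius c^k negligible before the height c^2, and its graph
    is subanalytic as the projection of a bounded real algebraic set. *)

Set Implicit Arguments.
Unset Strict Implicit.
Unset Printing Implicit Defensive.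
(* The lifting of functions to free abelian groups has the same short name. *)
Local Notation lift := fintype.lift.

(** * Alternating cochains on finite sequences of points *)
Section Cochains.
Variables (V : eqType) (M : zmodType).
Implicit Types (F G : seq V -> M) (chi psi : V -> int) (v w : seq V).

Definition tail_at a F : seq V -> M := fun v => F (a :: v).

(** The alternating product of a function chi of one point and a cochain F:
    the sum of (-1)^i chi(a_i) F(a_0, ..., omit a_i, ..., a_n).  The recursion
    is the expansion along the first point; with chi = 1 it is the simplicial
    coboundary.  Composing several of them expands a determinant. *)
Fixpoint wedge chi F v : M :=
  if v is a :: v' then F v' *~ chi a - wedge chi (tail_at a F) v' else 0.

Definition delta F := wedge (fun=> 1) F.

Lemma delta_cons F a v : delta F (a :: v) = F v - delta (tail_at a F) v.
Proof. by rewrite /delta /= mulr1z. Qed.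

Lemma eq_wedge chi psi F G v :
    (forall w, subseq w v -> size v = (size w).+1 -> F w = G w) ->
    {in v, chi =1 psi} ->
  wedge chi F v = wedge psi G v.
Proof.
elim: v F G => [//|a v IHv] F G FG cp /=.
rewrite FG ?subseq_cons // cp ?mem_head //; congr (_ - _).
apply: IHv => [w wv vw|x xv]; last by rewrite cp // inE xv orbT.
by apply: FG; rewrite /= ?eqxx // vw.
Qed.

Lemma eq_delta F G v :
    (forall w, subseq w v -> size v = (size w).+1 -> F w = G w) ->
  delta F v = delta G v.
Proof. by move=> FG; apply: eq_wedge. Qed.

Lemma wedge0 chi F v : (forall w, F w = 0) -> wedge chi F v = 0.
Proof.
elim: v F => [//|a v IHv] F F0 /=.
by rewrite F0 mul0rz IHv ?subr0 // => w; apply: F0.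
Qed.

Lemma wedgeB chi F G v :
  wedge chi (fun w => F w - G w) v = wedge chi F v - wedge chi G v.
Proof.
elim: v F G => [|a v IHv] F G /=; first by rewrite subr0.
by rewrite IHv mulrzBl !opprD !opprK addrACA.
Qed.

Lemma wedgeD chi F G v :
  wedge chi (fun w => F w + G w) v = wedge chi F v + wedge chi G v.
Proof.
elim: v F G => [|a v IHv] F G /=; first by rewrite addr0.
by rewrite IHv mulrzDl !opprD addrACA.
Qed.

Lemma wedgeZ chi F (c : int) v :
  wedge chi (fun w => F w *~ c) v = wedge chi F v *~ c.
Proof.
elim: v F => [|a v IHv] F /=; first by rewrite mul0rz.
by rewrite IHv mulrzBl mulrzAC.
Qed.

Lemma wedgeDl chi psi F v :
  wedge (fun a => chi a + psi a) F v = wedge chi F v + wedge psi F v.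
Proof.
elim: v F => [|a v IHv] F /=; first by rewrite addr0.
by rewrite IHv mulrzDr !opprD addrACA.
Qed.

Lemma wedge0l F v : wedge (fun=> 0) F v = 0.
Proof. by elim: v F => [//|a v IHv] F /=; rewrite IHv mulr0z subr0. Qed.

(** After expansion along the first point a, the two terms containing chi a
    cancel, which leaves the same statement for the remaining points. *)
Lemma wedge_sqr chi F v : wedge chi (wedge chi F) v = 0.
Proof.
elim: v F => [//|a v IHv] F /=.
rewrite -[tail_at a _]/(fun w => F w *~ chi a - wedge chi (tail_at a F) w).
by rewrite wedgeB wedgeZ IHv subr0 subrr.
Qed.

(** Polarisation of [wedge_sqr]. *)
Lemma wedgeC chi psi F v : wedge chi (wedge psi F) v = - wedge psi (wedge chi F) v.
Proof.
apply/eqP; rewrite -addr_eq0; apply/eqP.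
have := wedge_sqr (fun a => chi a + psi a) F v.
under [wedge _ F]funext => w do rewrite wedgeDl.
by rewrite wedgeD !wedgeDl !wedge_sqr add0r addr0 addrC.
Qed.

Lemma delta_sqr F v : delta (delta F) v = 0.
Proof. exact: wedge_sqr. Qed.

Lemma deltaE F v :
  delta F v = \sum_(i < size v) F (take i v ++ drop i.+1 v) *~ (-1) ^+ i.
Proof.
elim: v F => [|a v IHv] F; first by rewrite big_ord0.
rewrite delta_cons IHv big_ord_recl /= drop0 expr0 mulr1z; congr (_ + _).
rewrite -sumrN; apply: eq_bigr => i _.
by rewrite /tail_at exprS mulN1r mulrNz.
Qed.

End Cochains.

(** * Counting labelled simplices *)
Section Labels.
Variables (V I : eqType) (lam : V -> I).
Implicit Types (L : seq I) (v : seq V).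

Definition mark (i : I) (x : V) : int := (lam x == i)%:R.

(** The determinant of the matrix with entries [lam v_j == L_i]: for a sequence
    v as long as the duplicate-free list L it is the signature of the
    bijection between vertices and labels, or 0 when there is none. *)
Fixpoint count_simplex L : seq V -> int :=
  if L is i :: L' then wedge (mark i) (count_simplex L') else fun=> 1.

Lemma count_simplex_miss i L v :
  i \in L -> i \notin map lam v -> count_simplex L v = 0.
Proof.
elim: L v => [//|j L IHL] v; rewrite inE => iL iv.
have [->|ij] := eqVneq v [::]; first by [].
rewrite /= (@eq_wedge _ _ _ (mark j) _ (if i \in L then fun=> 0 else count_simplex L)) //.
  case: ifP iL => [_ _|_]; first exact: wedge0.
  rewrite orbF => /eqP <-; rewrite (@eq_wedge _ _ _ (fun=> 0) _ (count_simplex L)) ?wedge0l //.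
  move=> x xv; rewrite /mark; case: eqP => // lx.
  by rewrite -lx map_f in iv.
move=> w wv _; case: ifP => // {}iL; apply: IHL => //.
by apply: contra iv; apply/mem_subseq/map_subseq.
Qed.

(** A determinant with two equal rows. *)
Lemma count_simplex_repeat i L v : i \in L -> count_simplex (i :: L) v = 0.
Proof.
elim: L v => [//|j L IHL] v; rewrite inE; have [->|_ /= iL] := eqVneq i j.
  by rewrite /= wedge_sqr.
by rewrite wedgeC wedge0 ?oppr0 // => w; apply: IHL.
Qed.

(** The coboundary adds a row of ones to the determinant.  When all labels lie
    in i :: L this row is the sum of the rows of the labels in i :: L, and
    those of L already occur. *)
Lemma delta_count_simplex i L v :
  uniq (i :: L) -> {subset map lam v <= i :: L} ->
  delta (count_simplex L) v = count_simplex (i :: L) v.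
Proof.
move=> uL vL.
have -> : delta (count_simplex L) v =
    wedge (fun x => \sum_(j <- i :: L) mark j x) (count_simplex L) v.
  apply: eq_wedge => // x xv.
  have lxL : lam x \in i :: L by rewrite vL ?map_f.
  rewrite (bigD1_seq (lam x)) //= /mark eqxx big1 ?addr0 // => j.
  by rewrite eq_sym => /negPf ->.
have sumE L' : wedge (fun x => \sum_(j <- L') mark j x) (count_simplex L) v =
    \sum_(j <- L') count_simplex (j :: L) v.
  elim: L' => [|j L' IHL'].
    rewrite big_nil -[RHS](wedge0l (count_simplex L) v).
    by apply: eq_wedge => // x; rewrite big_nil.
  by rewrite big_cons -IHL' /= -wedgeDl; apply: eq_wedge => // x; rewrite big_cons.
rewrite sumE big_cons big1_seq ?addr0 // => j /= jL.
exact: count_simplex_repeat.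
Qed.

End Labels.

(** * Barycentric subdivision, acting on cochains *)
Section Subdivision.
Variables (V : eqType) (M : zmodType) (b : seq V -> V).
Implicit Types (F G : seq V -> M) (v w : seq V).

(** [sd m F v] is the value of F on the barycentric subdivision of the simplex
    with the m vertices v: the cone from [b v] over the subdivided boundary. *)
Fixpoint sd m F v : M :=
  if m is m'.+1 then delta (sd m' (tail_at (b v) F)) v else F v.

Definition iter_sd N m F : seq V -> M := iter N (sd m) F.

Lemma eq_sd m F G v : size v = m -> (forall w, size w = m -> F w = G w) ->
  sd m F v = sd m G v.
Proof.
elim: m F G v => [|m IHm] F G v /= sv FG; first exact: FG.
apply: eq_delta => w _; rewrite sv => -[sw].
by apply: IHm => // u su; apply: FG; rewrite /= su.
Qed.

Lemma sdB m F G v : sd m (fun w => F w - G w) v = sd m F v - sd m G v.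
Proof.
elim: m F G v => [//|m IHm] F G v /=.
rewrite -wedgeB; apply: eq_wedge => // w _ _; exact: IHm.
Qed.

Lemma iter_sd0 N m v : iter_sd N m (fun=> 0) v = 0.
Proof.
have sd0 F w : (forall u, F u = 0) -> sd m F w = 0.
  elim: m F w => [|m' IHm] F w F0 /=; first exact: F0.
  by apply: wedge0 => u; apply: IHm => u'; apply: F0.
by elim: N v => [//|N IHN] v; apply: sd0 => w; apply: IHN.
Qed.

(** Subdivision is a chain map.  A cone satisfies d(cone c) = c - cone(d c);
    as c is here itself the boundary of the simplex, subdivided, the term
    d c vanishes by induction and d^2 = 0.  The point [b v] is arbitrary. *)
Lemma sd_delta m F v : size v = m.+1 -> sd m.+1 (delta F) v = delta (sd m F) v.
Proof.
elim: m F v => [|m IHm] F v sv.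
  case: v sv => [//|a [|//]] _.
  by rewrite /= /tail_at !delta_cons /= /delta /= subr0.
rewrite -[LHS]/(delta (sd m.+1 (tail_at (b v) (delta F))) v).
pose Fb := tail_at (b v) F.
rewrite (@eq_delta _ _ _ (fun w => sd m.+1 F w - delta (sd m Fb) w)).
  by rewrite /delta wedgeB wedge_sqr subr0.
move=> w _; rewrite sv => -[sw].
rewrite -(IHm Fb w (esym sw)) -(sdB m.+1 F (delta Fb) w); exact: eq_sd.
Qed.

Lemma iter_sd_delta N m F v :
  size v = m.+1 -> iter_sd N m.+1 (delta F) v = delta (iter_sd N m F) v.
Proof.
elim: N v => [//|N IHN] v sv; rewrite /iter_sd /=.
rewrite -[LHS]/(sd m.+1 (iter_sd N m.+1 (delta F)) v).
rewrite (@eq_sd _ _ (delta (iter_sd N m F))) ?sd_delta //.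
Qed.

End Subdivision.

(** * The mesh of iterated subdivisions *)
Section Mesh.
Variables (R : realType) (V : normedModType R) (M : zmodType).
Implicit Types (F G : seq V -> M) (v w : seq V) (C : set V) (d : R).

Definition barycenter v : V := (size v)%:R^-1 *: \sum_(x <- v) x.

(** The part of convexity that subdivisions use; it is stable under
    intersection and holds for balls. *)
Definition barycentric_convex C :=
  forall v, v != [::] -> (forall x, x \in v -> C x) -> C (barycenter v).

Definition small C d v :=
  (forall x, x \in v -> C x) /\ (forall x y, x \in v -> y \in v -> `|x - y| <= d).

Lemma barycenterB v (c : V) : v != [::] ->
  barycenter v - c = (size v)%:R^-1 *: \sum_(x <- v) (x - c).
Proof.
move=> v0; rewrite /barycenter big_split /= sumrN big_const_seq count_predT.
rewrite iter_addr_0 scalerDr scalerN -[c *+ _]scaler_nat scalerA mulVf ?scale1r //.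
by rewrite pnatr_eq0 size_eq0.
Qed.

Lemma barycentric_convex_ball (c : V) d : barycentric_convex [set x | `|x - c| <= d].
Proof.
move=> v v0 vd /=.
have s0 : (0 : R) < (size v)%:R by rewrite ltr0n lt0n size_eq0.
rewrite barycenterB // normrZ normfV ger0_norm ?(ltW s0) //.
rewrite ler_pdivrMl //; apply: le_trans (ler_norm_sum _ _ _) _.
apply: (@le_trans _ _ (\sum_(x <- v) d)).
  rewrite !big_seq; apply: ler_sum => x xv; exact: vd.
by rewrite big_const_seq count_predT iter_addr_0 mulr_natl.
Qed.

Lemma barycentric_convexI C C' : barycentric_convex C -> barycentric_convex C' ->
  barycentric_convex (C `&` C').
Proof.
by move=> cC cC' v v0 vC; split; [apply: cC|apply: cC'] => // x /vC[].
Qed.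

Lemma barycenter_dist m d v x : (size v <= m.+1)%N ->
    (forall y, y \in v -> `|x - y| <= d) -> x \in v ->
  `|x - barycenter v| <= m%:R / m.+1%:R * d.
Proof.
move=> sv vd xv.
have v0 : v != [::] by case: v xv {vd sv}.
have s0 : (0 : R) < (size v)%:R by rewrite ltr0n lt0n size_eq0.
have d0 : 0 <= d by apply: le_trans (vd _ xv).
rewrite distrC barycenterB // normrZ normfV ger0_norm ?(ltW s0) //.
rewrite (perm_big _ (perm_to_rem xv)) big_cons /= subrr add0r.
apply: (@le_trans _ _ ((size v)%:R^-1 * ((size v).-1%:R * d))).
  rewrite ler_wpM2l ?invr_ge0 ?(ltW s0) //.
  apply: le_trans (ler_norm_sum _ _ _) _.
  apply: (@le_trans _ _ (\sum_(x <- rem x v) d)).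
    rewrite !big_seq; apply: ler_sum => y /mem_rem yv; rewrite distrC; exact: vd.
  by rewrite big_const_seq count_predT iter_addr_0 mulr_natl size_rem.
rewrite mulrA ler_wpM2r // mulrC ler_pdivlMr ?ltr0Sn // mulrAC.
rewrite ler_pdivrMr // -!natrM ler_nat.
case: (size v) sv s0 => [|s] //=; rewrite ltnS => sm _.
by rewrite mulnS [(m * _)%N]mulnS [(s * _)%N]mulnC leq_add2r.
Qed.

(** All cells of the subdivision are small: the barycentre b of v is within
    e = n / (n + 1) * d of the vertices of v, hence of every cell vertex, since
    these stay in the convex ball of centre b and radius e.  Recording this
    ball in the convex set C lets the induction on m go through. *)
Lemma sd_support n m C d F G v : (m <= n.+1)%N -> size v = m ->
    barycentric_convex C -> small C d v ->
    (forall w, size w = m -> small C (n%:R / n.+1%:R * d) w -> F w = G w) ->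
  sd barycenter m F v = sd barycenter m G v.
Proof.
elim: m C d F G v => [|m IHm] C d F G v mn sv cC [Cv dv] FG.
  by apply: FG => //; case: v sv {Cv dv}.
have v0 : v != [::] by case: v sv {Cv dv}.
set e := n%:R / _ * d in FG.
pose C' := C `&` [set x | `|x - barycenter v| <= e].
have vC' x : x \in v -> C' x.
  move=> xv; split; first exact: Cv.
  apply: barycenter_dist => //; first by rewrite sv.
  by move=> y yv; apply: dv.
apply: eq_delta => w wv; rewrite sv => -[sw].
apply: (IHm C' d) => //; first exact: ltnW.
- by apply: barycentric_convexI => //; apply: barycentric_convex_ball.
- split=> [x|x y] /(mem_subseq wv) xv; first exact: vC'.
  by move=> /(mem_subseq wv) yv; apply: dv.
move=> u su [uC ud]; apply: FG; first by rewrite /= su.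
have e0 : 0 <= e.
  rewrite mulr_ge0 ?divr_ge0 //.
  case: v v0 dv {sv Cv C' vC' wv uC} => // x v _ dv.
  by apply: le_trans (dv x x _ _); rewrite ?mem_head.
split=> [x|x y]; rewrite !inE.
  case/predU1P => [->|/uC[] //]; exact: cC.
case/predU1P => [->|xu] /predU1P[->|yu].
- by rewrite subrr normr0.
- by rewrite distrC; have [] := uC _ yu.
- by have [] := uC _ xu.
- exact: ud.
Qed.

Lemma iter_sd_support n N m C d F G v : (m <= n.+1)%N -> size v = m ->
    barycentric_convex C -> small C d v ->
    (forall w, size w = m -> small C ((n%:R / n.+1%:R) ^+ N * d) w -> F w = G w) ->
  iter_sd barycenter N m F v = iter_sd barycenter N m G v.
Proof.
move=> mn sv cC.
elim: N d v sv => [|N IHN] d v sv Cdv FG.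
  by rewrite expr0 mul1r in FG; exact: (FG v sv Cdv).
rewrite /iter_sd /=; apply: (@sd_support n m C d) => // w sw Cw.
apply: (IHN (n%:R / n.+1%:R * d)) => // u su.
by rewrite mulrA -exprSr; apply: FG.
Qed.

End Mesh.

(** * Simplices, subdivision and affine maps *)
Section Naturality.
Variables (V W : eqType).

Lemma wedge_map (M : zmodType) (L : V -> W) chi (F : seq W -> M) v :
  wedge chi F (map L v) = wedge (chi \o L) (F \o map L) v.
Proof. by elim: v F => [//|a v IHv] F /=; rewrite IHv. Qed.

Lemma count_simplex_map (I : eqType) (L : V -> W) (lam : W -> I) (J : seq I) v :
  count_simplex lam J (map L v) = count_simplex (lam \o L) J v.
Proof.
elim: J v => [//|i J IHJ] v /=; rewrite wedge_map.
by apply: eq_wedge => // w _ _ /=; apply: IHJ.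
Qed.

Lemma sd_map (M : zmodType) (bV : seq V -> V) (bW : seq W -> W) (L : V -> W) m
    (F : seq W -> M) v :
    (forall w, bW (map L w) = L (bV w)) ->
  sd bW m F (map L v) = sd bV m (F \o map L) v.
Proof.
move=> bL; elim: m F v => [//|m IHm] F v.
rewrite /= /delta wedge_map; apply: eq_wedge => // w _ _ /=.
by rewrite IHm bL.
Qed.

Lemma iter_sd_map (M : zmodType) (bV : seq V -> V) (bW : seq W -> W) (L : V -> W) N m
    (F : seq W -> M) v :
    (forall w, bW (map L w) = L (bV w)) ->
  iter_sd bW N m F (map L v) = iter_sd bV N m (F \o map L) v.
Proof.
move=> bL; elim: N v => [//|N IHN] v; rewrite /iter_sd /=.
rewrite (sd_map _ _ _ bL); congr sd; apply/funext => w; exact: IHN.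
Qed.

End Naturality.

Section StandardSimplex.
Variable R : realType.

Lemma rV_norm_le n (x : 'rV[R]_n) (e : R) : 0 <= e ->
  (`|x| <= e) <-> (forall j, `|x 0 j| <= e).
Proof.
move=> e0; rewrite /Num.Def.normr /= mx_normrE; split=> [xe j|xe].
  by apply: le_trans xe; apply/bigmax_geP; right; exists (0, j).
apply: bigmax_le => // -[i j] _ /=; rewrite ord1; exact: xe.
Qed.

Definition vertex q (j : 'I_q.+1) : 'rV[R]_q.+1 := delta_mx 0 j.

Definition vertices q : seq 'rV[R]_q.+1 := map (@vertex q) (enum 'I_q.+1).

Lemma size_vertices q : size (vertices q) = q.+1.
Proof. by rewrite size_map size_enum_ord. Qed.

Lemma nth_vertices q x0 (j : 'I_q.+1) : nth x0 (vertices q) j = vertex j.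
Proof. by rewrite (nth_map j) ?size_enum_ord // nth_ord_enum. Qed.

Definition coord_face q (L : seq 'I_q.+1) : set 'rV[R]_q.+1 :=
  @std_simplex R q `&` [set x | forall j, j \notin L -> x 0 j = 0].

Lemma vertex_std q (j : 'I_q.+1) : @std_simplex R q (vertex j).
Proof.
split=> [i|]; first by rewrite mxE eqxx /= ler0n.
rewrite (bigD1 j) //= mxE !eqxx big1 ?addr0 // => i /negPf ij.
by rewrite mxE ij andbF.
Qed.

Lemma barycenterE n (v : seq 'rV[R]_n) j :
  barycenter v 0 j = (size v)%:R^-1 * \sum_(x <- v) x 0 j.
Proof. by rewrite mxE summxE. Qed.

Lemma std_simplex_convex q : barycentric_convex (@std_simplex R q).
Proof.
move=> v v0 vD.
have s0 : (0 : R) < (size v)%:R by rewrite ltr0n lt0n size_eq0.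
split=> [i|].
  rewrite barycenterE mulr_ge0 ?invr_ge0 ?(ltW s0) //.
  by rewrite big_seq sumr_ge0 // => x /vD[].
under eq_bigr do rewrite barycenterE.
rewrite -mulr_sumr exchange_big /= (eq_big_seq (fun=> 1)) => [|x /vD[]//].
by rewrite big_const_seq count_predT iter_addr_0 mulVf ?gt_eqF.
Qed.

Lemma coord_face_convex q (L : seq 'I_q.+1) : barycentric_convex (coord_face L).
Proof.
apply: barycentric_convexI; first exact: std_simplex_convex.
move=> v v0 vD j jL; rewrite barycenterE big_seq big1 ?mulr0 // => x xv.
exact: vD.
Qed.

Lemma std_simplex_coord_le1 q (x : 'rV[R]_q.+1) j : @std_simplex R q x -> x 0 j <= 1.
Proof.
move=> [x0 <-]; rewrite (bigD1 j) //= lerDl; exact: sumr_ge0.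
Qed.

Lemma std_simplex_dist q (x y : 'rV[R]_q.+1) :
  @std_simplex R q x -> @std_simplex R q y -> `|x - y| <= 1.
Proof.
move=> Dx Dy; apply/rV_norm_le => // j; rewrite !mxE ler_norml.
have := std_simplex_coord_le1 j Dx; have := std_simplex_coord_le1 j Dy.
move: Dx Dy => [/(_ j) x0 _] [/(_ j) y0 _] y1 x1; apply/andP; split.
  by rewrite lerBrDr -lerBrDl opprK addrC; apply: (le_trans y1); rewrite lerDl.
by rewrite lerBlDr; apply: (le_trans x1); rewrite lerDl.
Qed.

Lemma small_std q (v : seq 'rV[R]_q.+1) (C : set 'rV[R]_q.+1) :
    C `<=` @std_simplex R q -> (forall x, x \in v -> C x) ->
  small C 1 v.
Proof.
move=> CD vC; split=> // x y /vC/CD Dx /vC/CD Dy; exact: std_simplex_dist.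
Qed.

(** Sperner's lemma, oriented and iterated.  Counting all labels i :: L on the
    simplex i :: L amounts, through [delta_count_simplex] and [iter_sd_delta],
    to counting the labels L on its faces; the faces containing the vertex i
    lack some vertex j of L, hence its label, so only the face opposite to i
    contributes, and it contributes 1 by induction. *)
Lemma sperner_count q (lam : 'rV[R]_q.+1 -> 'I_q.+1) N (L : seq 'I_q.+1) :
    (forall x, @std_simplex R q x -> 0 < x 0 (lam x)) -> uniq L ->
  iter_sd (@barycenter R _) N (size L) (count_simplex lam L) (map (@vertex q) L) = 1.
Proof.
move=> lamP; elim: L => [_|i L IHL uL].
  have iter_nil F : iter_sd (@barycenter R 'rV[R]_q.+1) N 0 F [::] = F [::] :> int.
    by elim: N => [//|N IHN]; rewrite /iter_sd /= in IHN *.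
  by rewrite iter_nil.
have lam_face J x : coord_face J x -> lam x \in J.
  move=> [Dx x0]; apply: contraT => /x0 xl.
  by have := lamP x Dx; rewrite xl ltxx.
have small_face J K : {subset K <= J} -> small (coord_face J) 1 (map (@vertex q) K).
  move=> KJ; apply: small_std; first by move=> x [].
  move=> x /mapP[j jK ->]; split; first exact: vertex_std.
  move=> l lJ; rewrite mxE; case: (eqVneq l j) => [lj|_ //].
  by rewrite lj KJ in lJ.
rewrite (@iter_sd_support _ _ _ (size L) N _ (coord_face (i :: L)) 1 _
  (delta (count_simplex lam L))) ?size_map //; last first.
- move=> w _ [wC _]; rewrite (delta_count_simplex (i := i)) // => l /mapP[x xw ->].
  by apply: lam_face; apply: wC.
- exact: small_face.
- exact: coord_face_convex.
rewrite iter_sd_delta ?size_map //= delta_cons.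
have /andP[iL uL'] := uL.
rewrite IHL // (@eq_delta _ _ _ (fun=> 0)) ?/delta ?wedge0 ?subr0 //.
move=> w wL; rewrite size_map => sw; rewrite /tail_at.
have [K KL wK] : exists2 K, subseq K L & w = map (@vertex q) K.
  have /subseqP[msk sm ->] := wL.
  by exists (mask msk L); rewrite ?mask_subseq // map_mask.
rewrite {}wK {wL} size_map in sw *.
have [j jL jK] : exists2 j, j \in L & j \notin K.
  apply/allPn; apply: contraL isT => /allP LK.
  have := uniq_leq_size uL' LK.
  by rewrite sw ltnn.
rewrite (@iter_sd_support _ _ _ (size L) N _ (coord_face (i :: K)) 1 _ (fun=> 0)) //.
- exact: iter_sd0.
- by rewrite /= size_map; exact: esym sw.
- exact: coord_face_convex.
- apply: (small_face (i :: K) (i :: K)) => //.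
move=> u _ [uC _]; apply: (count_simplex_miss (i := j)) => //.
apply/mapP => -[x /uC /lam_face]; rewrite inE => /predU1P[ji|jK'] xj.
  by rewrite -ji -xj jL in iL.
by rewrite xj jK' in jK.
Qed.

End StandardSimplex.

(** * Singular chains and their boundary *)
Section FreeGroups.
Variables (K : choiceType) (M : lmodType int) (f : K -> M).
Implicit Types c : {freeg K / int}.

Lemma fgliftB c c' : fglift f (c - c') = fglift f c - fglift f c'.
Proof. exact: lift_is_additive. Qed.

Lemma fglift0 : fglift f 0 = 0.
Proof. by rewrite -[0 in LHS](subrr 0) fgliftB subrr. Qed.

Lemma fgliftD c c' : fglift f (c + c') = fglift f c + fglift f c'.
Proof.
rewrite -[c' in LHS]opprK fgliftB -[- c']sub0r fgliftB fglift0.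
by rewrite sub0r opprK.
Qed.

Lemma fglift_sum (I : Type) (r : seq I) (c : I -> {freeg K / int}) :
  fglift f (\sum_(i <- r) c i) = \sum_(i <- r) fglift f (c i).
Proof. by apply: (big_morph _ fgliftD fglift0). Qed.

Lemma fgliftE c : fglift f c = \sum_(s <- dom c) coeff s c *: f s.
Proof.
rewrite -{1}[c]freeg_sumE fglift_sum; apply: eq_bigr => s _; exact: liftU.
Qed.

Lemma fglift1 s : fglift f << s >> = f s.
Proof. by rewrite liftU scale1r. Qed.

Lemma fgliftZ (m : int) c : fglift f (m *: c) = m *: fglift f c.
Proof.
rewrite -[c in LHS]freeg_sumE scaler_sumr fglift_sum fgliftE scaler_sumr.
apply: eq_bigr => s _.
suff -> : m *: << coeff s c *g s >> = << m * coeff s c *g s >>.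
  by rewrite liftU scalerA.
by apply/eqP/freeg_eqP => x; rewrite coeffZ !coeffU mulrA.
Qed.

End FreeGroups.

Section Faces.
Variables (R : realType) (N : nat).

Lemma coface_std q (i : 'I_q.+2) (x : 'rV[R]_q.+1) :
  @std_simplex R q x -> @std_simplex R q.+1 (coface i x).
Proof.
move=> [x0 x1]; split=> [j|].
  by rewrite mxE; case: unliftP => [k _|_] //=.
rewrite (bigD1 i) //= mxE unlift_none /= add0r -x1.
rewrite (reindex_onto (lift i) (fun j => odflt ord0 (unlift i j))) /=; last first.
  by move=> j; rewrite eq_sym; case: unliftP => [k ->|->] //=; rewrite eqxx.
apply: eq_big => [j|j _]; last by rewrite mxE liftK.
by rewrite liftK eqxx eq_sym neq_lift.
Qed.

Lemma coface_vertex q (i : 'I_q.+2) (j : 'I_q.+1) :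
  coface i (vertex R j) = vertex R (lift i j).
Proof.
apply/rowP => k; rewrite !mxE eqxx /=.
case: unliftP => [l ->|->] /=; last by rewrite (negPf (neq_lift i j)).
by rewrite mxE eqxx (inj_eq lift_inj).
Qed.

(** This is what identifies the boundary of a singular simplex with a
    coboundary in the sense of [delta]. *)
Lemma face_vertices q (i : 'I_q.+2) :
  take i (vertices R q.+1) ++ drop i.+1 (vertices R q.+1) =
  map (coface i) (vertices R q).
Proof.
have sz : size (take i (vertices R q.+1) ++ drop i.+1 (vertices R q.+1)) = q.+1.
  rewrite size_cat size_take size_drop size_vertices ltn_ord subSS.
  by rewrite subnKC // -ltnS ltn_ord.
apply: (@eq_from_nth _ 0) => [|j]; rewrite sz.
  by rewrite (size_map (coface i)) size_vertices.
move=> jq.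
rewrite (nth_map 0) ?size_vertices // -[j]/(nat_of_ord (Ordinal jq)).
rewrite nth_vertices coface_vertex.
rewrite -(nth_vertices 0 (lift i (Ordinal jq))) nth_cat size_take size_vertices ltn_ord /=.
rewrite /bump; case: (ltnP j i) => [ji|ij].
  by rewrite nth_take // add0n.
by rewrite nth_drop addSn subnKC // add1n.
Qed.

Lemma coface_barycenter q (i : 'I_q.+2) (w : seq 'rV[R]_q.+1) :
  barycenter (map (coface i) w) = coface i (barycenter w).
Proof.
apply/rowP => j; rewrite [RHS]mxE barycenterE size_map big_map.
case E: (unlift i j) => [k|] /=; last first.
  by rewrite big1 ?mulr0 // => x _; rewrite mxE E.
by rewrite barycenterE; congr (_ * _); apply: eq_bigr => x _; rewrite mxE E.
Qed.

Lemma normalizeE q (s : 'rV[R]_q.+1 -> 'rV[R]_N) x :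
  @std_simplex R q x -> normalize s x = s x.
Proof. by move=> Dx; rewrite /normalize patchT ?inE. Qed.

Lemma eq_normalize q (s s' : 'rV[R]_q.+1 -> 'rV[R]_N) :
  (forall x, @std_simplex R q x -> s x = s' x) -> normalize s = normalize s'.
Proof.
move=> ss'; apply/funext => x; rewrite /normalize /patch; case: ifP => //.
by rewrite inE => /ss'.
Qed.

Definition affine_simplex q (v : seq 'rV[R]_N) (x : 'rV[R]_q.+1) : 'rV[R]_N :=
  \sum_(j < q.+1) x 0 j *: v`_j.

End Faces.

Section Boundary.
Variables (R : realType) (N : nat).

Lemma affine_simplex_vertices q (x : 'rV[R]_q.+1) : affine_simplex (vertices R q) x = x.
Proof.
rewrite [RHS]row_sum_delta; apply: eq_bigr => j _; rewrite nth_vertices //.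
Qed.

Lemma affine_simplex_coface q r (i : 'I_r.+2) (v : seq 'rV[R]_r.+1) (x : 'rV[R]_q.+1) :
  size v = q.+1 -> affine_simplex (map (coface i) v) x = coface i (affine_simplex v x).
Proof.
move=> sv; apply/rowP => j; rewrite [RHS]mxE summxE.
case E: (unlift i j) => [k|] /=; last first.
  rewrite big1 // => l _.
  by rewrite mxE (nth_map 0) ?sv // mxE E mulr0.
rewrite summxE; apply: eq_bigr => l _.
by rewrite !mxE (nth_map 0) ?sv // mxE E.
Qed.

Lemma affine_simplex_std q r (v : seq 'rV[R]_r.+1) (x : 'rV[R]_q.+1) :
    size v = q.+1 -> (forall y, y \in v -> @std_simplex R r y) ->
    @std_simplex R q x ->
  @std_simplex R r (affine_simplex v x).
Proof.
move=> sv vD [x0 x1].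
have vj (j : 'I_q.+1) : @std_simplex R r v`_j by apply: vD; rewrite mem_nth ?sv.
split=> [i|].
  rewrite summxE sumr_ge0 // => j _; rewrite mxE mulr_ge0 //.
  by have [] := vj j.
under eq_bigr do rewrite summxE.
rewrite exchange_big /= -[RHS]x1; apply: eq_bigr => j _.
under eq_bigr do rewrite mxE.
by rewrite -mulr_sumr; have [_ ->] := vj j; rewrite mulr1.
Qed.

(** The singular simplex cut out of s by the points of v, as a cochain in v
    with values in chains; with it d^2 = 0 for singular chains becomes
    [delta_sqr]. *)
Definition affine_face r q (s : 'rV[R]_r.+1 -> 'rV[R]_N) (v : seq 'rV[R]_r.+1) :
  chain R N q := << normalize (s \o @affine_simplex R _ q v) >>.

Lemma boundaryU q (s : 'rV[R]_q.+2 -> 'rV[R]_N) :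
  boundary << s >> = \sum_(i < q.+2) (-1) ^+ i *: << face i s >> :> chain R N q.
Proof. by rewrite /boundary fglift1. Qed.

Lemma boundary_delta q (s : 'rV[R]_q.+2 -> 'rV[R]_N) :
  boundary << s >> = delta (@affine_face _ q s) (vertices R q.+1).
Proof.
rewrite boundaryU deltaE size_vertices; apply: eq_bigr => i _.
rewrite face_vertices -[RHS]scaler_int intz; congr (_ *: << _ >>).
apply: eq_normalize => x _ /=.
by rewrite affine_simplex_coface ?size_vertices // affine_simplex_vertices.
Qed.

Lemma boundary_boundaryU q (s : 'rV[R]_q.+3 -> 'rV[R]_N) :
  boundary (boundary << s >> : chain R N q.+1) = 0.
Proof.
rewrite boundaryU /boundary fglift_sum.
rewrite -[RHS](delta_sqr (@affine_face _ q s) (vertices R q.+2)) [RHS]deltaE size_vertices.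
apply: eq_bigr => i _; rewrite fgliftZ -[RHS]scaler_int intz; congr (_ *: _).
rewrite -/(boundary _) boundary_delta face_vertices /delta (wedge_map (coface i)).
apply: eq_wedge => // w wv; rewrite size_vertices => -[sw] /=.
congr << _ >>; apply: eq_normalize => x Dx /=; rewrite affine_simplex_coface //.
rewrite /face normalizeE //; apply: affine_simplex_std => // y /(mem_subseq wv) /mapP[j _ ->].
exact: vertex_std.
Qed.

Lemma dom_boundary q (c : chain R N q.+1) s :
  s \in dom (boundary c) -> exists t i, t \in dom c /\ s = face i t.
Proof.
rewrite /boundary fgliftE => /dom_sum_subset /flatten_mapP[t].
rewrite filter_predT => tc /domZ_subset.
case/dom_sum_subset/flatten_mapP => i _ /domZ_subset; rewrite domU1 inE => /eqP ->.
by exists t, i.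
Qed.

End Boundary.

(** * Winding numbers of chains *)
Section Winding.
Variables (R : realType) (N : nat).

(** All labels but the first: a simplex of dimension q has one vertex for each
    of them. *)
Definition labels q : seq 'I_q.+2 := map (lift ord0) (enum 'I_q.+1).

Lemma labels_enum q : ord0 :: labels q = enum 'I_q.+2.
Proof. by rewrite enum_ordSl. Qed.

Lemma labels_uniq q : uniq (ord0 :: labels q).
Proof. by rewrite labels_enum enum_uniq. Qed.

Lemma labels_full q i : i \in ord0 :: labels q.
Proof. by rewrite labels_enum mem_enum. Qed.

(** Signed number of cells of the k-th subdivision of s whose vertices carry
    all labels but the first. *)
Definition winding q (lam : 'rV[R]_N -> 'I_q.+2) (k : nat)
    (s : 'rV[R]_q.+1 -> 'rV[R]_N) : int :=
  iter_sd (@barycenter R _) k q.+1 (count_simplex (lam \o s) (labels q)) (vertices R q).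

Definition winding_number q (lam : 'rV[R]_N -> 'I_q.+2) k (c : chain R N q) : int :=
  fglift (winding lam k : _ -> int^o) c.

Lemma vertices_small q : small (@std_simplex R q) 1 (vertices R q).
Proof.
by apply: small_std => // x /mapP[j _ ->]; apply: vertex_std.
Qed.

Lemma iter_sd_vertices q (M : zmodType) k (F G : seq 'rV[R]_q.+1 -> M) :
    (forall w, size w = q.+1 ->
      small (@std_simplex R q) ((q%:R / q.+1%:R) ^+ k) w -> F w = G w) ->
  iter_sd (@barycenter R _) k q.+1 F (vertices R q) =
  iter_sd (@barycenter R _) k q.+1 G (vertices R q).
Proof.
move=> FG; apply: (@iter_sd_support _ _ _ q k q.+1 (@std_simplex R q) 1) => //.
- by rewrite size_vertices.
- exact: std_simplex_convex.
- exact: vertices_small.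
- by rewrite mulr1.
Qed.

Lemma eq_count_simplex (V I : eqType) (lam lam' : V -> I) (L : seq I) (v : seq V) :
  {in v, lam =1 lam'} -> count_simplex lam L v = count_simplex lam' L v.
Proof.
elim: L v => [//|i L IHL] v ll'; apply: eq_wedge => [w wv _|x xv].
  by apply: IHL => x xw; apply/ll'/(mem_subseq wv).
by rewrite /mark ll'.
Qed.

(** Counting cells on the boundary of a simplex is counting, inside it, the
    cells of one dimension more that carry every label. *)
Lemma sum_winding_face q (lam : 'rV[R]_N -> 'I_q.+2) k (s : 'rV[R]_q.+2 -> 'rV[R]_N) :
  \sum_(i < q.+2) (-1) ^+ i * winding lam k (face i s) =
  iter_sd (@barycenter R _) k q.+2
    (count_simplex (lam \o s) (ord0 :: labels q)) (vertices R q.+1).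
Proof.
transitivity (iter_sd (@barycenter R _) k q.+2
    (delta (count_simplex (lam \o s) (labels q))) (vertices R q.+1)); last first.
  apply: iter_sd_vertices => w _ _; rewrite (delta_count_simplex (i := ord0)) //.
    exact: labels_uniq.
  by move=> j _; apply: labels_full.
rewrite iter_sd_delta ?size_vertices // deltaE size_vertices.
apply: eq_bigr => i _; rewrite face_vertices -mulrzr intz mulrC; congr (_ * _).
rewrite (iter_sd_map (bV := @barycenter R _)); last exact: coface_barycenter.
apply: iter_sd_vertices => w _ [wD _] /=; rewrite count_simplex_map.
by apply: eq_count_simplex => x /wD xD; rewrite /face /= normalizeE.
Qed.

Lemma winding_number_boundary q (lam : 'rV[R]_N -> 'I_q.+2) k (c : chain R N q.+1) :
  winding_number lam k (boundary c) =
  \sum_(s <- dom c) coeff s c * iter_sd (@barycenter R _) k q.+2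
    (count_simplex (lam \o s) (ord0 :: labels q)) (vertices R q.+1).
Proof.
rewrite /winding_number /boundary [X in fglift _ X]fgliftE fglift_sum; apply: eq_bigr => s _.
rewrite fgliftZ fglift_sum -sum_winding_face; congr (_ * _).
by apply: eq_bigr => i _; rewrite fgliftZ fglift1.
Qed.

End Winding.

(** * Labelling the punctured Euclidean space *)
Lemma cvg_fin_sum (R : realType) (T : Type)
    (F : set_system T) {FF : Filter F} (I : Type) (r : seq I)
    (f : I -> T -> R) (l : I -> R) :
    (forall i, f i @ F --> l i) ->
  (fun x => \sum_(i <- r) f i x) @ F --> \sum_(i <- r) l i.
Proof.
move=> fl; elim: r => [|i r IHr].
  by rewrite big_nil; under eq_fun do rewrite big_nil; exact: cvg_cst.
rewrite big_cons; under eq_fun do rewrite big_cons.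
exact: cvgD.
Qed.

Lemma continuous_fin_sum (R : realType) (T : topologicalType) (I : Type)
    (r : seq I) (f : I -> T -> R) :
  (forall i, continuous (f i)) -> continuous (fun x => \sum_(i <- r) f i x).
Proof. by move=> cf x; apply: cvg_fin_sum => i; apply: cf. Qed.

Section Sectors.
Variable R : realType.

(** The n + 1 linear forms x_0, ..., x_(n-1) and - (x_0 + ... + x_(n-1)).  As
    they sum to 0 and vanish together only at the origin, each nonzero vector
    makes one of them positive and one of them negative. *)
Definition bform n (x : 'rV[R]_n) (i : 'I_n.+1) : R :=
  oapp (x 0) (- \sum_j x 0 j) (unlift ord_max i).

Lemma bform_lift n (x : 'rV[R]_n) j : bform x (lift ord_max j) = x 0 j.
Proof. by rewrite /bform liftK. Qed.

Lemma bform_max n (x : 'rV[R]_n) : bform x ord_max = - \sum_j x 0 j.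
Proof. by rewrite /bform unlift_none. Qed.

Lemma widen_lift n (j : 'I_n) : widen_ord (leqnSn n) j = lift ord_max j.
Proof. by apply/val_inj; rewrite /= /bump leqNgt ltn_ord. Qed.

Lemma bform_sum n (x : 'rV[R]_n) : \sum_i bform x i = 0.
Proof.
rewrite big_ord_recr /= bform_max.
by under eq_bigr do rewrite widen_lift bform_lift; rewrite subrr.
Qed.

Lemma bformZ n (c : R) (x : 'rV[R]_n) i : bform (c *: x) i = c * bform x i.
Proof.
case: (unliftP ord_max i) => [j ->|->]; first by rewrite !bform_lift mxE.
by rewrite !bform_max mulrN mulr_sumr; under eq_bigr do rewrite mxE.
Qed.

Lemma bform_eq0 n (x : 'rV[R]_n) : (forall i, 0 <= bform x i) -> x = 0.
Proof.
move=> x0; apply/rowP => j; rewrite mxE -bform_lift.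
have /eqP := bform_sum x; rewrite psumr_eq0 => [/allP/(_ (lift ord_max j))|//].
by rewrite mem_index_enum /= => /(_ isT)/eqP.
Qed.

Lemma bform_neg n (x : 'rV[R]_n) : x != 0 -> exists i, bform x i < 0.
Proof.
apply: contra_neqP => /forallNP x0; apply: bform_eq0 => i.
by rewrite leNgt; apply/negP.
Qed.

Lemma bform_pos n (x : 'rV[R]_n) : x != 0 -> exists i, 0 < bform x i.
Proof.
move=> x0; have [] := @bform_neg n (-1 *: x); first by rewrite scaleN1r oppr_eq0.
by move=> i; rewrite bformZ mulN1r oppr_lt0; exists i.
Qed.

Definition sector n (x : 'rV[R]_n) : 'I_n.+1 :=
  odflt ord0 [pick i | 0 < bform x i].

Lemma sector_pos n (x : 'rV[R]_n) : x != 0 -> 0 < bform x (sector x).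
Proof.
move=> /bform_pos[i xi]; rewrite /sector; case: pickP => [//|/(_ i)].
by rewrite xi.
Qed.

Lemma sectorZ n (c : R) (x : 'rV[R]_n) : 0 < c -> sector (c *: x) = sector x.
Proof.
move=> c0; rewrite /sector; congr odflt; apply: eq_pick => i.
by rewrite /= bformZ pmulr_rgt0.
Qed.

Lemma bform_continuous n (i : 'I_n.+1) : continuous (fun x : 'rV[R]_n => bform x i).
Proof.
case: (unliftP ord_max i) => [j ->|->].
  under eq_fun do rewrite bform_lift; exact: coord_continuous.
under eq_fun do rewrite bform_max.
have cs : continuous (fun x : 'rV[R]_n => \sum_j x 0 j).
  by apply: continuous_fin_sum => j; apply: coord_continuous.
by move=> x; apply: continuousN; apply: cs.
Qed.

Lemma std_simplex_compact q : compact (@std_simplex R q).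
Proof.
apply: bounded_closed_compact.
  exists 1; split=> // M M1 x Dx; apply/rV_norm_le; first exact: ltW (lt_trans _ M1).
  move=> j; rewrite ger0_norm; last by have [] := Dx.
  exact: le_trans (std_simplex_coord_le1 j Dx) (ltW M1).
rewrite (_ : @std_simplex R q = \bigcap_(i in @setT 'I_q.+1) [set x | 0 <= x 0 i] `&`
    [set x | \sum_i x 0 i = 1]); last first.
  apply/seteqP; split=> x [x0 x1]; split=> // i; [move=> _; exact: x0|exact: (x0 i I)].
apply: closedI.
  apply: closed_bigI => i _.
  move/continuous_closedP: (@coord_continuous R 1 q.+1 0 i).
  by move/(_ [set y | 0 <= y]); apply; apply: closed_ge.
have /continuous_closedP : continuous (fun x : 'rV[R]_q.+1 => \sum_i x 0 i).
  by apply: continuous_fin_sum => j; apply: coord_continuous.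
by move=> /(_ [set y | y = 1]); apply; apply: closed_eq.
Qed.

(** A Lebesgue number.  At each point some form is negative, hence on a
    neighbourhood; a cell inside this neighbourhood misses the corresponding
    label. *)
Lemma fine_cells_miss_label q n (h : 'rV[R]_q.+1 -> 'rV[R]_n) :
    {within @std_simplex R q, continuous h} ->
    (forall x, @std_simplex R q x -> h x != 0) ->
  exists2 d : R, 0 < d & forall w, w != [::] -> small (@std_simplex R q) d w ->
    exists i, i \notin map (fun x => sector (h x)) w.
Proof.
move=> /subspace_continuousP ch h0.
have /compact_near_coveringP cD := @std_simplex_compact q.
pose P (d : R) x :=
  exists i, forall y, @std_simplex R q y -> `|x - y| <= d -> bform (h y) i < 0.
have [|e /= e0 He] := cD _ (0^'+) P (at_right_proper_filter _).
  move=> x Dx; have [i xi] := bform_neg (h0 _ Dx).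
  have : \forall y \near x, @std_simplex R q y -> bform (h y) i < 0.
    have := cvg_comp _ _ (ch x Dx) (@bform_continuous n i (h x)).
    by move/(_ [set r | r < 0]); apply; apply: open_lt => //.
  move=> /nbhs_ballP[r /= r0 Hr].
  exists (ball x (r / 2), [set d : R | d < r / 2]) => /=.
    split; first by apply: nbhsx_ballx; rewrite divr_gt0.
    by apply: nbhs_right_lt; rewrite divr_gt0.
  move=> [x' d] /= [xx' dr]; exists i => y Dy yd; apply: Hr => //.
  rewrite (splitr r); apply: ball_triangle xx' _.
  by rewrite -ball_normE /=; apply: le_lt_trans dr.
have e2 : 0 < e / 2 by apply: divr_gt0.
exists (e / 2) => //.
move=> [//|x w] _ [wD wd].
have xw : x \in x :: w by rewrite mem_head.
have e2e : ball_ (fun y => `|y|) 0 e (e / 2).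
  by rewrite /= sub0r normrN gtr0_norm // ltr_pdivrMr // ltr_pMr // ltr1n.
have [i Hi] := He (e / 2) e2e e2 x (wD _ xw).
exists i; apply/mapP => -[y yw] yi.
have := Hi _ (wD _ yw) (wd _ _ xw yw).
by rewrite yi ltNge ltW // sector_pos // h0 //; apply: wD.
Qed.

End Sectors.

(** * The fundamental cycle of the sphere does not bound *)
Section Obstruction.
Variable R : realType.

Lemma mesh_to0 q (d : R) : 0 < d ->
  \forall k \near \oo, (q%:R / q.+1%:R : R) ^+ k <= d.
Proof.
move=> d0.
have : (fun k => (q%:R / q.+1%:R : R) ^+ k) @ \oo --> (0 : R).
  apply: cvg_expr; rewrite ger0_norm ?divr_ge0 // ltr_pdivrMr // mul1r ltr_nat //.
move/cvgr0Pnorm_le => /(_ _ d0); apply: filterS => k.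
by rewrite ger0_norm // exprn_ge0 // divr_ge0.
Qed.

(** A boundary in a set that maps continuously to the punctured space has
    winding number 0 as soon as the subdivision is fine enough for the finitely
    many simplices of the chain. *)
Lemma winding_number_boundary0 N q (X : set 'rV[R]_N) (a : 'rV[R]_N -> 'rV[R]_q.+1)
    (c : chain R N q.+1) :
    {within X, continuous a} -> (forall x, X x -> a x != 0) -> chain_in X c ->
  \forall k \near \oo, winding_number (fun x => sector (a x)) k (boundary c) = 0.
Proof.
move=> ca a0 cX.
have : \forall k \near \oo, forall s, s \in dom c ->
   iter_sd (@barycenter R _) k q.+2
    (count_simplex ((fun x => sector (a x)) \o s) (ord0 :: labels q)) (vertices R q.+1) = 0.
  suff H (L : seq ('rV[R]_q.+2 -> 'rV[R]_N)) : {subset L <= dom c} ->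
    \forall k \near \oo, forall s, s \in L ->
      iter_sd (@barycenter R _) k q.+2
      (count_simplex ((fun x => sector (a x)) \o s) (ord0 :: labels q)) (vertices R q.+1) = 0.
    exact: H.
  elim: L => [|s L IHL] Lc; first by near=> k.
  have [cs sX _] := cX s (Lc _ (mem_head _ _)).
  have sX' x : @std_simplex R q.+1 x -> X (s x) by move=> Dx; apply: sX; exists x.
  have [d d0 Hd] : exists2 d : R, 0 < d & forall w, w != [::] ->
      small (@std_simplex R q.+1) d w ->
      exists i, i \notin map (fun x => sector (a (s x))) w.
    apply: (@fine_cells_miss_label R q.+1 q.+1 (a \o s)) => [|x /sX'/a0 //].
    apply/subspace_continuousP => x Dx.
    move/subspace_continuousP: ca => /(_ _ (sX' _ Dx)).
    apply: cvg_trans; move/subspace_continuousP: cs => /(_ _ Dx) cs.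
    move=> A /= aA; have := cs _ aA.
    rewrite /= /within /= /nbhs /=.
    by apply: filterS => y Hy Dy; apply: Hy => //; apply: sX'.
  have {}IHL := IHL (fun t tL => Lc t (@mem_behead _ (s :: L) t tL)).
  near=> k => t; rewrite inE => /predU1P[->|tL].
    rewrite -[RHS](@iter_sd0 _ int (@barycenter R _) k q.+2 (vertices R q.+1)).
    apply: iter_sd_vertices => w sw [wD wd].
    have [||i iw] := Hd w; first by rewrite -size_eq0 sw.
      split=> // x y xw yw; apply: le_trans (wd _ _ xw yw) _.
      by near: k; apply: mesh_to0.
    by apply: count_simplex_miss iw; apply: labels_full.
  by move: t tL; near: k.
apply: filterS => k Hk; rewrite winding_number_boundary big_seq big1 // => s sc.
by rewrite Hk ?mulr0.
Unshelve. all: by end_near.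
Qed.

Lemma eq_winding N M q (lam : 'rV[R]_N -> 'I_q.+2) (lam' : 'rV[R]_M -> 'I_q.+2) k s s' :
    (forall x, @std_simplex R q x -> lam (s x) = lam' (s' x)) ->
  winding lam k s = winding lam' k s'.
Proof.
move=> ss'; apply: iter_sd_vertices => w _ [wD _].
by apply: eq_count_simplex => x /wD /ss'.
Qed.

Lemma winding_number_chain_map N M q (lam : 'rV[R]_N -> 'I_q.+2)
    (lam' : 'rV[R]_M -> 'I_q.+2) k (X : set 'rV[R]_M) (f : 'rV[R]_M -> 'rV[R]_N)
    (c : chain R M q) :
    chain_in X c -> (forall x, X x -> lam (f x) = lam' x) ->
  winding_number lam k (chain_map f c) = winding_number lam' k c.
Proof.
move=> cX ff; rewrite /winding_number /chain_map [X in fglift _ X]fgliftE fglift_sum.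
rewrite [RHS]fgliftE big_seq [RHS]big_seq; apply: eq_bigr => s sc.
rewrite fgliftZ fglift1.
suff -> : winding lam k (normalize (f \o s)) = winding lam' k s by [].
apply: eq_winding => x Dx.
rewrite normalizeE //= ff //; have [_ sX _] := cX s sc.
by apply: sX; exists x.
Qed.

End Obstruction.

Section TestCycle.
Variable R : realType.

Lemma cvg_rV (T : Type) (F : set_system T) {FF : Filter F} n
    (f : T -> 'rV[R]_n) (l : 'rV[R]_n) :
  (forall j, f t 0 j @[t --> F] --> l 0 j) -> f @ F --> l.
Proof.
move=> fl A [P Pl PA]; rewrite /nbhs /=.
have : \forall t \near F, forall j, P 0 j (f t 0 j).
  by apply: filter_forall => j; apply: fl; apply: Pl.
by apply: filterS => t Pt; apply: PA => i j; rewrite ord1.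
Qed.

Lemma continuous_rV (T : topologicalType) n (f : T -> 'rV[R]_n) x :
  (forall j, {for x, continuous (fun t => f t 0 j)}) -> {for x, continuous f}.
Proof. by move=> cf; apply: cvg_rV => j; apply: cf. Qed.

Lemma coface_continuous q (i : 'I_q.+2) : continuous (@coface R q i).
Proof.
move=> x; apply: continuous_rV => j.
have -> : (fun t => coface i t 0 j) = fun t : 'rV[R]_q.+1 => oapp (t 0) 0 (unlift i j).
  by apply/funext => t; rewrite mxE.
case: (unlift i j) => [k|] /=; [exact: coord_continuous|exact: cst_continuous].
Qed.

Lemma enorm_sqr n (x : 'rV[R]_n) : enorm x ^+ 2 = \sum_j x 0 j ^+ 2.
Proof. by rewrite sqr_sqrtr // sumr_ge0 // => j _; apply: sqr_ge0. Qed.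

Lemma enorm_ge0 n (x : 'rV[R]_n) : 0 <= enorm x. Proof. exact: sqrtr_ge0. Qed.

Lemma enorm_eq0 n (x : 'rV[R]_n) : enorm x = 0 -> x = 0.
Proof.
move=> x0; apply/rowP => j; rewrite mxE; apply/eqP; rewrite -sqrf_eq0.
have /eqP := enorm_sqr x; rewrite x0 expr0n eq_sym psumr_eq0 => [/allP/(_ j)|k _].
  by rewrite mem_index_enum => /(_ isT).
exact: sqr_ge0.
Qed.

Lemma enorm_gt0 n (x : 'rV[R]_n) : x != 0 -> 0 < enorm x.
Proof.
by move=> x0; rewrite lt_def enorm_ge0 andbT; apply: contra_neq x0; apply: enorm_eq0.
Qed.

Lemma enormZ n (c : R) (x : 'rV[R]_n) : enorm (c *: x) = `|c| * enorm x.
Proof.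
rewrite /enorm -sqrtr_sqr -sqrtrM ?sqr_ge0 // mulr_sumr; congr Num.sqrt.
by apply: eq_bigr => j _; rewrite mxE exprMn.
Qed.

Lemma enorm_continuous n : continuous (@enorm R n).
Proof.
move=> x; apply: (@continuous_comp _ _ _ (fun y : 'rV[R]_n => \sum_j y 0 j ^+ 2) Num.sqrt).
  apply: continuous_fin_sum => j y.
  apply: (@continuous_comp _ _ _ (fun y : 'rV[R]_n => y 0 j) (fun r => r ^+ 2)).
    exact: coord_continuous.
  exact: exprn_continuous.
exact: sqrt_continuous.
Qed.

Definition unit_vector n (x : 'rV[R]_n) := (enorm x)^-1 *: x.

Lemma unit_vector_sphere n (x : 'rV[R]_n.+1) : x != 0 -> @sphere R n (unit_vector x).
Proof.
move=> /enorm_gt0 x0; rewrite /sphere /= enormZ ger0_norm ?invr_ge0 ?ltW //.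
by rewrite mulVf ?gt_eqF.
Qed.

Lemma unit_vector_continuous n (x : 'rV[R]_n) :
  x != 0 -> {for x, continuous (@unit_vector n)}.
Proof.
move=> /enorm_gt0 x0; apply: continuous_rV => j.
have -> : (fun t => unit_vector t 0 j) = fun t : 'rV[R]_n => (enorm t)^-1 * t 0 j.
  by apply/funext => t; rewrite mxE.
apply: continuousM; last exact: coord_continuous.
by apply: continuousV; rewrite ?gt_eqF //; apply: enorm_continuous.
Qed.

(** The affine map sending the standard simplex to a simplex around the origin.
    It makes the forms [bform] equal to the barycentric coordinates, up to a
    constant, so that [sector] is a Sperner labelling. *)
Definition centered q (x : 'rV[R]_q.+2) : 'rV[R]_q.+1 :=
  \row_j (x 0 (lift ord_max j) - q.+2%:R^-1).

Lemma bform_centered q (x : 'rV[R]_q.+2) i :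
  @std_simplex R q.+1 x -> bform (centered x) i = x 0 i - q.+2%:R^-1.
Proof.
move=> [_ x1]; case: (unliftP ord_max i) => [j ->|->].
  by rewrite bform_lift mxE.
rewrite bform_max; under eq_bigr do rewrite mxE.
rewrite sumrB big_const_ord iter_addr_0.
have -> : \sum_(i < q.+1) x 0 (lift ord_max i) = 1 - x 0 ord_max.
  move: x1; rewrite big_ord_recr /= => <-; rewrite addrK.
  by apply: eq_bigr => j _; rewrite widen_lift.
have -> : (q.+2%:R^-1 : R) *+ q.+1 = 1 - q.+2%:R^-1.
  apply/eqP; rewrite eq_sym subr_eq -mulrSr.
  by rewrite -[_^-1 *+ _]mulr_natl mulfV // pnatr_eq0.
by ring.
Qed.

Lemma centered_continuous q : continuous (@centered q).
Proof.
move=> x; apply: continuous_rV => j.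
have -> : (fun t => centered t 0 j) = fun t : 'rV[R]_q.+2 => t 0 (lift ord_max j) - q.+2%:R^-1.
  by apply/funext => t; rewrite mxE.
by apply: continuousB; [exact: coord_continuous|exact: cst_continuous].
Qed.

Lemma centered_face_neq0 q (i : 'I_q.+2) (x : 'rV[R]_q.+1) :
  @std_simplex R q x -> centered (coface i x) != 0.
Proof.
move=> Dx; apply/eqP => c0.
have := bform_centered i (coface_std i Dx).
rewrite c0 [in RHS]mxE unlift_none /= add0r => /eqP.
rewrite -(scale0r 0) bformZ mul0r eq_sym oppr_eq0 invr_eq0 pnatr_eq0 //.
Qed.

(** Discontinuous at the barycentre, but the faces are mapped to the sphere
    continuously, and d^2 = 0 holds formally. *)
Definition radial_simplex q (x : 'rV[R]_q.+2) : 'rV[R]_q.+1 := unit_vector (centered x).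

Definition test_cycle q : chain R q.+1 q := boundary << @radial_simplex q >>.

Lemma test_cycle_sphere q : chain_in (@sphere R q) (test_cycle q).
Proof.
move=> s /dom_boundary[t [i []]]; rewrite domU1 inE => /eqP -> -> {t s}.
split.
- apply: (subspace_eq_continuous (f := @radial_simplex q \o coface i)).
    by move=> x; rewrite inE => Dx; apply/esym/normalizeE.
  apply: continuous_in_subspaceT => x; rewrite inE => Dx.
  apply: continuous_comp; first exact: coface_continuous.
  apply: continuous_comp; first exact: centered_continuous.
  exact/unit_vector_continuous/centered_face_neq0.
- move=> _ [x Dx <-]; rewrite /face normalizeE //.
  exact/unit_vector_sphere/centered_face_neq0.
- by apply: eq_normalize => x Dx; rewrite /face normalizeE.
Qed.

Lemma winding_number_test_cycle q k :
  winding_number (@sector R _) k (test_cycle q) = 1.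
Proof.
rewrite winding_number_boundary domU1 big_seq1 coeffU eqxx mulr1 mul1r labels_enum.
have := @sperner_count R q.+1 (@sector R _ \o @radial_simplex q) k (enum 'I_q.+2) _
  (enum_uniq _).
rewrite size_enum_ord; apply => x Dx /=.
(* At the barycentre all coordinates are positive, and any label will do. *)
have [c0|c0] := eqVneq (centered x) 0.
  have := bform_centered (sector (radial_simplex x)) Dx.
  rewrite c0 -(scale0r 0) bformZ mul0r => /esym/eqP; rewrite subr_eq0 => /eqP ->.
  by rewrite invr_gt0 ltr0n.
rewrite sectorZ ?invr_gt0 ?enorm_gt0 //.
have := sector_pos c0; rewrite bform_centered // subr_gt0; apply: le_lt_trans.
by rewrite invr_ge0 ler0n.
Qed.

(** If a chain bounded the image of z, the winding number of z itself would be
    0 at fine levels, because a (f u) and u have the same label; then so would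
    be that of the test cycle, which is a multiple of z up to a boundary of the
    sphere. *)
Theorem radial_obstruction N p (X : set 'rV[R]_N) (a : 'rV[R]_N -> 'rV[R]_p.+2)
    (f : 'rV[R]_p.+2 -> 'rV[R]_N) (z : chain R p.+2 p.+1) (c : chain R N p.+2) :
    {within X, continuous a} -> (forall x, X x -> a x != 0) ->
    (forall u, @sphere R p.+1 u -> exists2 r : R, 0 < r & a (f u) = r *: u) ->
    fundamental_cycle z -> chain_in X c -> boundary c = chain_map f z -> False.
Proof.
move=> ca a0 af [[zS _] zgen] cX bc.
have [|m [b [bS tb]]] := zgen (test_cycle p.+1).
  by split; [exact: test_cycle_sphere|exact: boundary_boundaryU].
have Wz k : winding_number (fun x => sector (a x)) k (boundary c) =
    winding_number (@sector R _) k z.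
  rewrite bc; apply: winding_number_chain_map zS _ => u /af[r r0 ->].
  exact: sectorZ.
have c1 := winding_number_boundary0 ca a0 cX.
have b1 : \forall k \near \oo, winding_number (fun x => sector (id x)) k (boundary b) = 0.
  apply: winding_number_boundary0 bS.
    by apply: continuous_subspaceT => x; apply: cvg_id.
  move=> x xS; apply/eqP => x0; move: xS; rewrite /sphere /= x0.
  by rewrite -(scale0r 0) enormZ normr0 mul0r => /esym/eqP; rewrite oner_eq0.
near \oo => k.
have ck : winding_number (fun x => sector (a x)) k (boundary c) = 0 by near: k.
have bk : winding_number (fun x => sector (id x)) k (boundary b) = 0 by near: k.
have := winding_number_test_cycle p.+1 k.
have -> : test_cycle p.+1 = boundary b + m *: z by rewrite -tb subrK.
rewrite /winding_number fgliftD fgliftZ -/(winding_number _ _ _) -/(winding_number _ _ _).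
rewrite -Wz ck bk.
by rewrite scaler0 addr0.
Unshelve. all: by end_near.
Qed.

End TestCycle.

(** * Complex powers and square roots *)
Section ComplexPowers.
Variable R : realType.

Lemma continuous_exprn (T : topologicalType) (f : T -> R) k x :
  {for x, continuous f} -> {for x, continuous (fun t => f t ^+ k)}.
Proof.
move=> cf; apply: (@continuous_comp _ _ _ f (fun r => r ^+ k)) => //.
exact: exprn_continuous.
Qed.

Lemma continuous_sqrt (T : topologicalType) (f : T -> R) x :
  {for x, continuous f} -> {for x, continuous (fun t => Num.sqrt (f t))}.
Proof.
by move=> cf; apply: (@continuous_comp _ _ _ f Num.sqrt) => //; apply: sqrt_continuous.
Qed.

Lemma continuous_complex_exp (T : topologicalType) (f g : T -> R) k x :
    {for x, continuous f} -> {for x, continuous g} ->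
  {for x, continuous (fun t => complex.Re (Complex (f t) (g t) ^+ k))} /\
  {for x, continuous (fun t => complex.Im (Complex (f t) (g t) ^+ k))}.
Proof.
move=> cf cg; elim: k => [|k [IHr IHi]]; first by split; apply: cst_continuous.
have ReE t : complex.Re (Complex (f t) (g t) ^+ k.+1) =
    f t * complex.Re (Complex (f t) (g t) ^+ k) - g t * complex.Im (Complex (f t) (g t) ^+ k).
  by rewrite exprS; case: (_ ^+ k).
have ImE t : complex.Im (Complex (f t) (g t) ^+ k.+1) =
    f t * complex.Im (Complex (f t) (g t) ^+ k) + g t * complex.Re (Complex (f t) (g t) ^+ k).
  by rewrite exprS; case: (_ ^+ k).
split.
  rewrite (_ : (fun t => _) = fun t => f t * complex.Re (Complex (f t) (g t) ^+ k) -
      g t * complex.Im (Complex (f t) (g t) ^+ k)); last exact/funext.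
  by apply: continuousB; apply: continuousM.
rewrite (_ : (fun t => _) = fun t => f t * complex.Im (Complex (f t) (g t) ^+ k) +
    g t * complex.Re (Complex (f t) (g t) ^+ k)); last exact/funext.
by apply: continuousD; apply: continuousM.
Qed.

(** [sqrt_re] and [sqrt_im] are the two parts of the principal square root of
    a + i b, a > 0; in this form their continuity is apparent. *)
Definition sqrt_re (a b : R) : R := Num.sqrt ((Num.sqrt (a ^+ 2 + b ^+ 2) + a) / 2).
Definition sqrt_im (a b : R) : R := b / (2 * sqrt_re a b).

Lemma sqrt_re_gt0 a b : 0 < a -> 0 < sqrt_re a b.
Proof.
by move=> a0; rewrite sqrtr_gt0 divr_gt0 // ltr_wpDl // sqrtr_ge0.
Qed.

Lemma sqr_sqrt_re_im a b : 0 < a ->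
  Complex (sqrt_re a b) (sqrt_im a b) ^+ 2 = Complex a b.
Proof.
move=> a0; have p0 := sqrt_re_gt0 b a0.
have s0 : 0 <= a ^+ 2 + b ^+ 2 by rewrite addr_ge0 ?sqr_ge0.
set m := Num.sqrt (a ^+ 2 + b ^+ 2).
have m2 : m ^+ 2 = a ^+ 2 + b ^+ 2 by rewrite sqr_sqrtr.
have ma0 : 0 < m + a by rewrite ltr_wpDl // sqrtr_ge0.
have p2 : sqrt_re a b ^+ 2 = (m + a) / 2.
  by rewrite sqr_sqrtr // divr_ge0 // ltW.
have p_neq0 : sqrt_re a b != 0 by rewrite gt_eqF.
have q2 : sqrt_im a b ^+ 2 = (m - a) / 2.
  rewrite /sqrt_im expr_div_n exprMn p2.
  have -> : b ^+ 2 = (m - a) * (m + a) by rewrite -subr_sqr m2; ring.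
  by field; rewrite gt_eqF.
have pq : sqrt_re a b * sqrt_im a b = b / 2 by rewrite /sqrt_im; field.
rewrite expr2; apply/eqP; rewrite eq_complex /= -!expr2 p2 q2.
rewrite [sqrt_im _ _ * _]mulrC pq; apply/andP; split; apply/eqP; lra.
Qed.

Lemma sqrt_re_im_real c : 0 < c -> sqrt_re (c ^+ 2) 0 = c /\ sqrt_im (c ^+ 2) 0 = 0.
Proof.
move=> c0; split; last by rewrite /sqrt_im mul0r.
rewrite /sqrt_re expr0n addr0 sqrtr_sqr ger0_norm ?exprn_ge0 ?ltW //.
have -> : (c ^+ 2 + c ^+ 2) / 2 = c ^+ 2 by lra.
by rewrite sqrtr_sqr gtr0_norm.
Qed.

Lemma continuous_sqrt_re_im (T : topologicalType) (f g : T -> R) x :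
    {for x, continuous f} -> {for x, continuous g} -> 0 < f x ->
  {for x, continuous (fun t => sqrt_re (f t) (g t))} /\
  {for x, continuous (fun t => sqrt_im (f t) (g t))}.
Proof.
move=> cf cg f0.
have cre : {for x, continuous (fun t => sqrt_re (f t) (g t))}.
  apply: continuous_sqrt; apply: continuousM; last exact: cst_continuous.
  apply: continuousD => //; apply: continuous_sqrt.
  by apply: continuousD; apply: continuous_exprn.
split=> //; apply: continuousM => //; apply: continuousV.
  by rewrite gt_eqF // mulr_gt0 // sqrt_re_gt0.
by apply: continuousM => //; apply: cst_continuous.
Qed.

End ComplexPowers.

(** * Coordinates on the hypersurface *)
Section Coordinates.
Variables (R : realType) (n : nat).
Implicit Types (v : 'rV[R]_(n.+1 * 2)) (x : 'rV[R]_n) (y : R).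

Lemma coord_vec_mx_continuous j l :
  continuous (fun v : 'rV[R]_(n.+1 * 2) => vec_mx v j l).
Proof.
have -> : (fun v : 'rV[R]_(n.+1 * 2) => vec_mx v j l) = fun v => v 0 (mxvec_index j l).
  by apply/funext => v; rewrite mxE.
exact: coord_continuous.
Qed.

Lemma enorm_sqr_vec_mx v : enorm v ^+ 2 = \sum_j \sum_l vec_mx v j l ^+ 2.
Proof.
rewrite enorm_sqr (reindex _ (curry_mxvec_bij _ _)) /=.
rewrite [RHS]pair_bigA /=; apply: eq_bigr => -[i j] _ /=; by rewrite mxE.
Qed.

Definition real_point x y : 'rV[R]_(n.+1 * 2) :=
  real_embedding (\row_j oapp (x 0) y (unlift ord_max j)).

Lemma vec_mx_real_point x y j l :
  vec_mx (real_point x y) j l = if l == 0 then oapp (x 0) y (unlift ord_max j) else 0.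
Proof. by rewrite mxvecK mxE; case: ifP => // _; rewrite mxE. Qed.

Lemma ccoord_real_point_lift x y j :
  ccoord (real_point x y) (lift ord_max j) = (x 0 j)%:C%C.
Proof. by rewrite /ccoord !vec_mx_real_point /= liftK. Qed.

Lemma ccoord_real_point_max x y : ccoord (real_point x y) ord_max = y%:C%C.
Proof. by rewrite /ccoord !vec_mx_real_point /= unlift_none. Qed.

Lemma enorm_sqr_real_point x y :
  enorm (real_point x y) ^+ 2 = enorm x ^+ 2 + y ^+ 2.
Proof.
rewrite enorm_sqr_vec_mx big_ord_recr /= enorm_sqr; congr (_ + _).
  apply: eq_bigr => j _; rewrite !big_ord_recl big_ord0 !vec_mx_real_point /=.
  by rewrite expr0n /= !addr0 widen_lift liftK.
by rewrite !big_ord_recl big_ord0 !vec_mx_real_point /= expr0n /= !addr0 unlift_none.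
Qed.

Lemma hypersurfaceE k v : hypersurface k v <->
  \sum_(j < n) ccoord v (lift ord_max j) ^+ 2 = ccoord v ord_max ^+ k.
Proof.
rewrite /hypersurface /=; under eq_bigr do rewrite widen_lift.
by split=> [/eqP|->]; rewrite ?subrr // subr_eq0 => /eqP.
Qed.

Lemma hypersurface_real_point k x y :
  hypersurface k (real_point x y) <-> enorm x ^+ 2 = y ^+ k.
Proof.
rewrite hypersurfaceE ccoord_real_point_max enorm_sqr.
under eq_bigr do rewrite ccoord_real_point_lift -rmorphXn.
rewrite -rmorph_sum -rmorphXn; split=> [/complexI //|-> //].
Qed.

End Coordinates.

(** * The horn and the map to the sphere that detects choking *)
Section Horn.
Variables (R : realType) (n k : nat) (sg : R).
Hypotheses (k_gt2 : (2 < k)%N) (sg2 : sg ^+ 2 = 1) (sgk : sg ^+ k = 1).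

(** The squared distance to the origin of (c^k u, c^2), for |u| = 1. *)
Definition radius_poly (c : R) : R := c ^+ 4 + c ^+ (2 * k).

Lemma radius_poly0 : radius_poly 0 = 0.
Proof.
by rewrite /radius_poly !expr0n muln_eq0 /= add0r; case: k k_gt2.
Qed.

Definition profile (t : R) : R :=
  xget 0 [set c | 0 <= c /\ radius_poly c = t ^+ 2].

Lemma radius_poly_lt c d : 0 <= c -> c < d -> radius_poly c < radius_poly d.
Proof.
move=> c0 cd; have d0 : 0 <= d by apply: le_trans c0 (ltW cd).
by rewrite ltrD // ltrXn2r // muln_eq0 /=; case: k k_gt2.
Qed.

Lemma profileP t : 0 <= profile t /\ radius_poly (profile t) = t ^+ 2.
Proof.
rewrite /profile; case: xgetP => [//|none].
have [c /andP[c0 _] Pc] : exists2 c, c \in `[0, 1 + t ^+ 2] & radius_poly c = t ^+ 2.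
  have t0 : 0 <= t ^+ 2 by apply: sqr_ge0.
  apply: IVT; first by rewrite addr_ge0.
    have cP x : {for x, continuous radius_poly}.
      by rewrite /radius_poly; apply: continuousD; apply: exprn_continuous.
    exact: continuous_subspaceT.
  have P1 : t ^+ 2 <= radius_poly (1 + t ^+ 2).
    have le1 : 1 <= 1 + t ^+ 2 by rewrite lerDl.
    apply: (@le_trans _ _ ((1 + t ^+ 2) ^+ 4)).
      apply: (@le_trans _ _ (1 + t ^+ 2)); first by rewrite lerDr.
      by rewrite -[leLHS]expr1 ler_weXn2l.
    by rewrite lerDl exprn_ge0 // (le_trans _ le1).
  by rewrite radius_poly0 minEle maxEle (le_trans t0 P1) t0.
by case: (none c).
Qed.

Lemma profile_ge0 t : 0 <= profile t. Proof. by have [] := profileP t. Qed.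

Lemma radius_poly_profile t : radius_poly (profile t) = t ^+ 2.
Proof. by have [] := profileP t. Qed.

Lemma profile_uniq c t : 0 <= c -> radius_poly c = t ^+ 2 -> profile t = c.
Proof.
have [p0 pt] := profileP t; move=> c0 ct.
case: (ltgtP (profile t) c) => // /radius_poly_lt; rewrite pt ct ltxx => /(_ _)//.
  by move/(_ p0).
by move/(_ c0).
Qed.

Lemma profile_gt0 t : 0 < t -> 0 < profile t.
Proof.
move=> t0; rewrite lt_def profile_ge0 andbT; apply/eqP => p0.
have := radius_poly_profile t; rewrite p0 radius_poly0.
by move=> /esym/eqP; rewrite sqrf_eq0 gt_eqF.
Qed.

Lemma profile0 : profile 0 = 0.
Proof.
by apply: profile_uniq => //; rewrite radius_poly0 expr0n.
Qed.

Lemma profile_le1 t : 0 <= t <= 1 -> profile t <= 1.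
Proof.
move=> /andP[t0 t1]; rewrite leNgt; apply/negP => p1.
have := radius_poly_lt ler01 p1; rewrite radius_poly_profile /radius_poly !expr1n.
apply/negP; rewrite -leNgt; apply: (@le_trans _ _ 1); last by rewrite lerDl.
by rewrite expr_le1.
Qed.

(** The height of the horn is comparable to t: as c <= 1 and 2k >= 4, the two
    terms of t^2 = c^4 + c^(2k) satisfy c^(2k) <= c^4. *)
Lemma profile_sqr_ge t : 0 <= t <= 1 -> t <= 2 * profile t ^+ 2.
Proof.
move=> t01; have /andP[t0 _] := t01.
have p1 := profile_le1 t01; have p0 := profile_ge0 t.
have Pt := radius_poly_profile t.
have le4 : profile t ^+ (2 * k) <= profile t ^+ 4.
  by apply: ler_wiXn2l => //; apply: (@leq_trans (2 * 2)) => //; rewrite leq_mul2l ltnW.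
rewrite -(@ler_pXn2r _ 2) ?nnegrE ?mulr_ge0 ?exprn_ge0 //.
rewrite exprMn -exprM -Pt /radius_poly.
have := exprn_ge0 4 p0; move: le4; move: (_ ^+ 4) (_ ^+ (2 * k)) => a b; lra.
Qed.

Lemma profile_pow4_lipschitz s t :
  `|profile s ^+ 4 - profile t ^+ 4| <= `|s ^+ 2 - t ^+ 2|.
Proof.
rewrite -2!radius_poly_profile /radius_poly.
wlog st : s t / profile t <= profile s => [H|].
  case: (leP (profile t) (profile s)) => [/H //|/ltW/H].
  by rewrite distrC [in X in _ <= X]distrC.
have h m : profile t ^+ m <= profile s ^+ m by rewrite lerXn2r ?nnegrE ?profile_ge0.
rewrite !ger0_norm ?subr_ge0 //; first by have := h (2 * k)%N; lra.
exact: lerD.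
Qed.

Lemma profile_continuous : continuous profile.
Proof.
have c4 : continuous (fun t => profile t ^+ 4).
  move=> t; apply/cvgrPdist_le => e e0.
  have /cvgrPdist_le/(_ e e0) := @exprn_continuous R 2 t.
  by apply: filterS => s; apply: le_trans; apply: profile_pow4_lipschitz.
have -> : profile = fun t => Num.sqrt (Num.sqrt (profile t ^+ 4)).
  apply/funext => t; rewrite (_ : 4 = 2 * 2)%N // exprM sqrtr_sqr.
  by rewrite ger0_norm ?exprn_ge0 ?profile_ge0 // sqrtr_sqr ger0_norm ?profile_ge0.
suff H t : {for t, continuous (fun t => Num.sqrt (Num.sqrt (profile t ^+ 4)))} by exact: H.
by do 2!apply: continuous_sqrt; apply: c4.
Qed.

(** The square root c of the height serves as parameter, so that the radius
    c^k of the sphere is a polynomial in it even when k is odd. *)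
Definition horn (tu : R * 'rV[R]_n) : 'rV[R]_(n.+1 * 2) :=
  real_point (profile tu.1 ^+ k *: tu.2) (sg * profile tu.1 ^+ 2).

Lemma horn_in_link tu : 0 <= tu.1 -> enorm tu.2 = 1 ->
  link (hypersurface k) tu.1 (horn tu).
Proof.
case: tu => t u /= t0 u1; split.
  apply/hypersurface_real_point; rewrite enormZ exprMn u1 expr1n mulr1.
  by rewrite real_normK ?num_real // exprMn sgk mul1r -!exprM mulnC.
apply/eqP; rewrite /= -(@eqrXn2 _ 2) ?enorm_ge0 // enorm_sqr_real_point.
rewrite enormZ exprMn u1 expr1n mulr1 real_normK ?num_real // exprMn sg2 mul1r.
by rewrite -(radius_poly_profile t) /radius_poly -!exprM addrC (mulnC k).
Qed.

(** A square root of w^k on the half-plane sg * Re w > 0. *)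
Definition root_w (v : 'rV[R]_(n.+1 * 2)) : R[i] :=
  let a := sg * vec_mx v ord_max 0 in let b := sg * vec_mx v ord_max 1 in
  Complex (sqrt_re a b) (sqrt_im a b) ^+ k.

(** The real part of z / root_w, up to the positive factor |root_w|^2. *)
Definition choke_map (v : 'rV[R]_(n.+1 * 2)) : 'rV[R]_n :=
  \row_j complex.Re (ccoord v (lift ord_max j) * conjc (root_w v)).

Lemma sqr_root_w v : 0 < sg * re_w v -> root_w v ^+ 2 = ccoord v ord_max ^+ k.
Proof.
move=> w0; rewrite /root_w -exprM mulnC exprM sqr_sqrt_re_im //.
have -> : Complex (sg * vec_mx v ord_max 0) (sg * vec_mx v ord_max 1) =
    sg%:C%C * ccoord v ord_max.
  by apply/eqP; rewrite eq_complex /= !mul0r subr0 addr0 !eqxx.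
by rewrite exprMn -rmorphXn sgk mul1r.
Qed.

(** With zeta = z * conj g and g^2 = w^k, the equation of the hypersurface gives
    sum zeta_j^2 = |w|^(2k) > 0, impossible if all zeta_j are imaginary. *)
Lemma choke_map_neq0 v : hypersurface k v -> 0 < sg * re_w v -> choke_map v != 0.
Proof.
move=> /hypersurfaceE Xv w0; apply/eqP => c0.
have w_neq0 : ccoord v ord_max ^+ k != 0.
  rewrite expf_neq0 //; apply: contraTneq w0 => /eqP.
  by rewrite eq_complex /= => /andP[/eqP w0 _]; rewrite /re_w w0 mulr0 ltxx.
pose zeta j := ccoord v (lift ord_max j) * conjc (root_w v).
have sum_zeta : \sum_j zeta j ^+ 2 = ccoord v ord_max ^+ k * conjc (ccoord v ord_max ^+ k).
  under eq_bigr do rewrite exprMn.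
  by rewrite -mulr_suml Xv -rmorphXn sqr_root_w.
have : 0 < \sum_j zeta j ^+ 2.
  by rewrite sum_zeta lt_def mulf_neq0 ?conjc_eq0 //= mulcJ_ge0.
suff le0 : \sum_j zeta j ^+ 2 <= 0 by move=> /lt_le_trans/(_ le0); rewrite ltxx.
apply: sumr_le0 => j _.
have : complex.Re (zeta j) = 0.
  by move/rowP/(_ j): c0; rewrite !mxE.
case: (zeta j) => a b /= ->; rewrite expr2 lecE /=.
by rewrite !mul0r mulr0 addr0 eqxx sub0r oppr_le0 -expr2 sqr_ge0.
Qed.

Lemma choke_map_continuous v : 0 < sg * re_w v -> {for v, continuous choke_map}.
Proof.
move=> w0; apply: continuous_rV => j.
have -> : (fun t => choke_map t 0 j) = fun t =>
    vec_mx t (lift ord_max j) 0 * complex.Re (root_w t) +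
    vec_mx t (lift ord_max j) 1 * complex.Im (root_w t).
  apply/funext => t; rewrite mxE; case: (root_w t) => a b /=.
  by rewrite mulrN opprK.
have csg l : {for v, continuous (fun t : 'rV[R]_(n.+1 * 2) => sg * vec_mx t ord_max l)}.
  apply: continuousM; [exact: cst_continuous|exact: coord_vec_mx_continuous].
have [cP cQ] := continuous_sqrt_re_im (csg 0) (csg 1) w0.
have [cre cim] := continuous_complex_exp k cP cQ.
by apply: continuousD; apply: continuousM => //; apply: coord_vec_mx_continuous.
Qed.

Lemma choke_map_horn tu : 0 < tu.1 ->
  choke_map (horn tu) = profile tu.1 ^+ (2 * k) *: tu.2.
Proof.
case: tu => t u /= t0; have p0 := profile_gt0 t0.
apply/rowP => j; rewrite !mxE.
rewrite ccoord_real_point_lift /root_w !vec_mx_real_point /= unlift_none /=.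
rewrite mulrA -expr2 sg2 mul1r mulr0.
have [-> ->] := sqrt_re_im_real p0.
rewrite complexr0 -rmorphXn conjc_real -rmorphM /= mxE.
by rewrite mulrAC -exprD addnn mul2n.
Qed.

End Horn.

(** * Choking *)
Section InnerMetric.
Variables (R : realType) (N : nat).

Lemma enormN n (x : 'rV[R]_n) : enorm (- x) = enorm x.
Proof. by rewrite -scaleN1r enormZ normrN1 mul1r. Qed.

Lemma curve_length_ge_dist (X : set 'rV[R]_N) x y g :
  curve_in X x y g -> ((enorm (x - y))%:E <= curve_length g)%E.
Proof.
move=> [_ _ g0 g1]; apply: ereal_sup_ubound; exists [:: 1].
  by split=> //=; rewrite ltr01.
by rewrite /= big_nat1 /= g0 g1 -enormN opprB.
Qed.

Lemma inner_dist_ge_dist (X : set 'rV[R]_N) x y :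
  ((enorm (x - y))%:E <= inner_dist X x y)%E.
Proof.
apply: le_ereal_inf_tmp => _ [g [gX _] <-]; exact: curve_length_ge_dist gX.
Qed.

Lemma diam_ge (d : 'rV[R]_N -> 'rV[R]_N -> \bar R) (A : set 'rV[R]_N) x y :
  A x -> A y -> (d x y <= diam d A)%E.
Proof. by move=> Ax Ay; apply: ereal_sup_ubound; exists x => //; exists y. Qed.

Lemma supp_simplex q (c : chain R N q) s x :
  s \in dom c -> @std_simplex R q x -> supp c (s x).
Proof. by move=> sc Dx; exists s => //; exists x. Qed.

Lemma dom_chain_map M q (f : 'rV[R]_M -> 'rV[R]_N) (c : chain R M q) s :
  s \in dom (chain_map f c) -> exists t, t \in dom c /\ s = normalize (f \o t).
Proof.
rewrite /chain_map fgliftE => /dom_sum_subset/flatten_mapP[t].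
rewrite filter_predT => tc /domZ_subset; rewrite domU1 inE => /eqP ->.
by exists t.
Qed.

End InnerMetric.

Lemma vec_mx_le_enorm (R : realType) n (v : 'rV[R]_(n.+1 * 2)) j l :
  `|vec_mx v j l| <= enorm v.
Proof.
rewrite -(@ler_pXn2r _ 2) ?nnegrE ?enorm_ge0 // enorm_sqr_vec_mx real_normK ?num_real //.
have sq_ge0 i m : 0 <= vec_mx v i m ^+ 2 by apply: sqr_ge0.
rewrite (bigD1 j) //= (bigD1 l) //= -addrA lerDl.
by rewrite addr_ge0 // ?sumr_ge0 // => i _; rewrite sumr_ge0.
Qed.

Section Choking.
Variables (R : realType) (p k : nat) (sg : R).
Hypotheses (k_gt2 : (2 < k)%N) (sg2 : sg ^+ 2 = 1) (sgk : sg ^+ k = 1).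

(** The support of a bounding chain meets the horn at height c^2 >= t / 2, so
    that a diameter below t / 4 keeps it where sg * Re w > 0. *)
Lemma horn_chokes :
  chokes (hypersurface k) (inner_dist (hypersurface k)) (@horn R p.+2 k sg).
Proof.
exists (1 / 4); first by rewrite divr_gt0.
have : \forall t \near (0 : R)^'+, 0 < t <= 1.
  near=> t; apply/andP; split; near: t; [exact: nbhs_right_gt|exact: nbhs_right_le].
apply: filterS => t /andP[t0 t1] z c fz cX bc.
rewrite leNgt; apply/negP => small_c.
pose a := @choke_map R p.+2 k sg.
pose X' := [set v | hypersurface k v /\ 0 < sg * @re_w R p.+2 v].
have ca : {within X', continuous a}.
  apply: continuous_in_subspaceT => v; rewrite inE => -[_ w0].
  exact: choke_map_continuous.
have a0 v : X' v -> a v != 0 by move=> [Xv w0]; apply: choke_map_neq0 Xv w0.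
have af u : @sphere R p.+1 u -> exists2 r : R, 0 < r & a (horn k sg (t, u)) = r *: u.
  move=> _; exists (profile k t ^+ (2 * k)).
    by rewrite exprn_gt0 // profile_gt0.
  by rewrite /a choke_map_horn.
(* If the image of z is the zero chain, the empty chain bounds it. *)
have [b0|b_neq0] := eqVneq (boundary c) 0.
  apply: (@radial_obstruction R _ _ _ a (fun u => horn k sg (t, u)) z 0 ca a0 af fz).
    by move=> s; rewrite dom0.
  by rewrite -bc b0; apply: fglift0.
(* Any simplex of the boundary provides a point common to the chain and the horn. *)
have [v0 v0c v0h] :
    exists2 v0, supp c v0 & exists2 u, @sphere R p.+1 u & v0 = horn k sg (t, u).
  have [s0 s0c] : exists s0, s0 \in dom (boundary c).
    move: b_neq0; rewrite -dom_eq0; case: (dom _) => // s0 L _.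
    by exists s0; rewrite mem_head.
  have [s [i [sc s0E]]] := dom_boundary s0c.
  have [s' [s'z s0E']] : exists s', s' \in dom z /\
      s0 = normalize ((fun u => horn k sg (t, u)) \o s').
    by apply: dom_chain_map; rewrite -bc.
  have Dv := @vertex_std R p.+1 ord0.
  exists (s0 (vertex R ord0)).
    by rewrite s0E /face normalizeE //; apply: supp_simplex => //; apply: coface_std.
  exists (s' (vertex R ord0)); last by rewrite s0E' normalizeE.
  have [_ s'S _] := fz.1.1 _ s'z; apply: s'S.
  by exists (vertex R ord0).
apply: (radial_obstruction ca a0 af fz _ bc) => s sc.
have [cs sX ns] := cX s sc; split=> // _ [x Dx <-].
have [Xs _] : link (hypersurface k) t (s x) by apply: sX; exists x.
split=> //.
have := le_lt_trans (inner_dist_ge_dist (hypersurface k) v0 (s x))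
  (le_lt_trans (diam_ge _ v0c (supp_simplex sc Dx)) small_c).
rewrite lte_fin => near_v0.
have := le_lt_trans (vec_mx_le_enorm (v0 - s x) ord_max 0) near_v0.
have -> : vec_mx (v0 - s x) ord_max 0 = re_w v0 - re_w (s x).
  by rewrite /re_w !mxE.
case: v0h => u _ ->.
have -> : re_w (horn k sg (t, u)) = sg * profile k t ^+ 2.
  by rewrite /re_w vec_mx_real_point /= unlift_none.
have := profile_sqr_ge k_gt2 (t := t); rewrite t1 ltW // => /(_ isT).
have sg1 : `|sg| = 1 by apply/eqP; rewrite -sqr_norm_eq1 sg2.
have nrm y : `|y| = `|sg * y| by rewrite normrM sg1 mul1r.
rewrite (nrm (_ - _)) mulrBr [sg * (sg * _)]mulrA -[sg * sg]expr2 sg2 mul1r ltr_norml.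
move: (_ ^+ 2) (sg * _) => c2 r tc /andP[_ cr]; lra.
Unshelve. all: by end_near. Qed.

End Choking.

(** * The real part and the topology of the horn *)
Section RealPart.
Variables (R : realType) (n k : nat).
Implicit Type v : 'rV[R]_(n.+1 * 2).

Lemma real_point_of v : @real_points R n v ->
  v = real_point (\row_j vec_mx v (lift ord_max j) 0) (re_w v).
Proof.
move=> rv; apply: (can_inj vec_mxK); apply/matrixP => j l.
rewrite vec_mx_real_point; case: ifP => [/eqP -> |].
  by case: (unliftP ord_max j) => [i ->|->] //=; rewrite mxE.
by case: l => -[|[|//]] // i _; rewrite -(rv j); congr (vec_mx v j _); apply/val_inj.
Qed.

Lemma real_points_real_point x y : @real_points R n (real_point x y).
Proof. by move=> j; rewrite vec_mx_real_point. Qed.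

Lemma re_w_real_point x y : re_w (@real_point R n x y) = y.
Proof. by rewrite /re_w vec_mx_real_point /= unlift_none. Qed.

Lemma real_part_hypersurface :
  hypersurface k `&` @real_points R n = @real_embedding R n @` @real_hypersurface R n k.
Proof.
have sum_sqr (x : 'rV[R]_n.+1) : \sum_(i < n) x 0 (widen_ord (leqnSn n) i) ^+ 2 =
    enorm (\row_j x 0 (lift ord_max j)) ^+ 2.
  by rewrite enorm_sqr; apply: eq_bigr => i _; rewrite mxE widen_lift.
have embE (x : 'rV[R]_n.+1) :
    real_embedding x = real_point (\row_j x 0 (lift ord_max j)) (x 0 ord_max).
  congr real_embedding; apply/rowP => j; rewrite mxE.
  by case: (unliftP ord_max j) => [i ->|->] //=; rewrite mxE.
apply/seteqP; split=> [v [Xv rv]|_ [x Hx <-]].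
  exists (\row_j vec_mx v j 0).
    rewrite /real_hypersurface /= sum_sqr; apply/eqP; rewrite subr_eq0; apply/eqP.
    move: Xv; rewrite {1}(real_point_of rv) hypersurface_real_point mxE => <-.
    by congr (enorm _ ^+ 2); apply/rowP => j; rewrite !mxE.
  rewrite embE mxE {3}(real_point_of rv); congr real_point.
  by apply/rowP => j; rewrite !mxE.
rewrite embE; split; last exact: real_points_real_point.
apply/hypersurface_real_point; rewrite -sum_sqr.
by apply/eqP; rewrite -subr_eq0; apply/eqP.
Qed.

Lemma cvg_vec_mx (T : Type) (F : set_system T) {FF : Filter F}
    (f : T -> 'rV[R]_(n.+1 * 2)) v :
  (forall j l, vec_mx (f t) j l @[t --> F] --> vec_mx v j l) -> f @ F --> v.
Proof.
move=> fv; apply: cvg_rV => i; case/mxvec_indexP: i => j l.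
have vE (w : 'rV[R]_(n.+1 * 2)) : w 0 (mxvec_index j l) = vec_mx w j l by rewrite mxE.
by rewrite vE; under eq_fun do rewrite vE; apply: fv.
Qed.

(** The weighted homotheties (s^k z, s^2 w), 0 <= s <= 1, join every point to
    the origin inside the hypersurface. *)
Lemma hypersurface_connected : (0 < k)%N -> connected (@hypersurface R n k).
Proof.
rewrite lt0n => k0; pose gam v (s : R) : 'rV[R]_(n.+1 * 2) :=
  mxvec (\matrix_(j, l) (s ^+ (if j == ord_max then 2 else k) * vec_mx v j l)).
have gamE v s j l : vec_mx (gam v s) j l = s ^+ (if j == ord_max then 2 else k) * vec_mx v j l.
  by rewrite mxvecK mxE.
have ccoord_gam v s j : ccoord (gam v s) j =
    (s ^+ (if j == ord_max then 2 else k))%:C%C * ccoord v j.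
  by rewrite /ccoord !gamE; apply/eqP; rewrite eq_complex /= !mul0r subr0 addr0 !eqxx.
have gamX v s : hypersurface k v -> hypersurface k (gam v s).
  move=> /hypersurfaceE Xv; apply/hypersurfaceE.
  rewrite ccoord_gam eqxx exprMn -Xv mulr_sumr; apply: eq_bigr => j _.
  rewrite ccoord_gam eq_sym (negPf (neq_lift _ _)) exprMn -!rmorphXn -!exprM.
  by rewrite mulnC.
have gam_cont v : continuous (gam v).
  move=> s; apply: cvg_vec_mx => j l; under eq_fun do rewrite gamE.
  by rewrite gamE; apply: cvgMl; exact: exprn_continuous.
have gam1 v : gam v 1 = v.
  by apply: (can_inj vec_mxK); apply/matrixP => j l; rewrite gamE expr1n mul1r.
have -> : @hypersurface R n k = \bigcup_(v in hypersurface k) (gam v @` `[0, 1]).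
  apply/seteqP; split=> [v Xv|_ [v Xv [s _ <-]]]; last exact: gamX.
  by exists v => //; exists 1; rewrite ?gam1 //= in_itv /= ler01 lexx.
apply: bigcup_connected => [|v _].
  exists 0 => v _; exists 0; first by rewrite /= in_itv /= lexx ler01.
  apply: (can_inj vec_mxK); apply/matrixP => j l; rewrite gamE expr0n !mxE.
  by case: ifP => _ /=; rewrite ?(negPf k0) mul0r.
apply: connected_continuous_connected; first exact: segment_connected.
exact: continuous_subspaceT.
Qed.

End RealPart.

Section HornMap.
Variables (R : realType) (p k : nat) (sg : R).
Hypotheses (k_gt2 : (2 < k)%N) (sg2 : sg ^+ 2 = 1) (sgk : sg ^+ k = 1).

Notation horn := (@horn R p.+1 k sg).

Lemma horn_map_continuous : continuous horn.
Proof.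
have cont_pow m : continuous (fun tu : R * 'rV[R]_p.+1 => profile k tu.1 ^+ m).
  suff H tu : {for tu, continuous (fun tu : R * 'rV[R]_p.+1 => profile k tu.1 ^+ m)}.
    exact: H.
  apply: continuous_exprn; apply: continuous_comp; first exact: cvg_fst.
  exact: profile_continuous.
move=> tu; apply: cvg_vec_mx => j l; under eq_fun do rewrite vec_mx_real_point.
rewrite vec_mx_real_point; case: ifP => _; last exact: cvg_cst.
case: (unlift ord_max j) => [i|] /=.
  under eq_fun do rewrite mxE.
  rewrite mxE; apply: cvgM; first exact: cont_pow.
  by apply: (@continuous_comp _ _ _ snd (fun u : 'rV[R]_p.+1 => u 0 i));
    [exact: cvg_snd|exact: coord_continuous].
by apply: cvgM; [exact: cvg_cst|exact: cont_pow].
Qed.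

Lemma vec_mx_horn_lift tu j :
  vec_mx (horn tu) (lift ord_max j) 0 = profile k tu.1 ^+ k * tu.2 0 j.
Proof. by rewrite vec_mx_real_point /= liftK /= mxE. Qed.

Lemma vec_mx_horn_max tu : vec_mx (horn tu) ord_max 0 = sg * profile k tu.1 ^+ 2.
Proof. by rewrite vec_mx_real_point /= unlift_none. Qed.

Lemma vec_mx_horn_im tu j l : l != 0 -> vec_mx (horn tu) j l = 0.
Proof. by move=> /negPf l0; rewrite vec_mx_real_point l0. Qed.

Lemma sphere_coord_le1 (u : 'rV[R]_p.+1) j : @sphere R p u -> `|u 0 j| <= 1.
Proof.
move=> u1; rewrite -(@ler_pXn2r _ 2) ?nnegrE // expr1n real_normK ?num_real //.
have := enorm_sqr u; rewrite u1 expr1n => ->; rewrite (bigD1 j) //= lerDl.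
by apply: sumr_ge0 => i _; apply: sqr_ge0.
Qed.

Definition pole : 'rV[R]_p.+1 := delta_mx 0 ord0.

Lemma pole_sphere : @sphere R p pole.
Proof.
apply/eqP; rewrite /= -(@eqrXn2 _ 2) ?enorm_ge0 // enorm_sqr expr1n.
rewrite (bigD1 ord0) //= big1 ?addr0 => [|i i0]; rewrite mxE ?eqxx ?expr1n //=.
by rewrite (negPf i0) expr0n.
Qed.

Lemma horn_origin u : horn (0, u) = 0.
Proof.
apply: (can_inj vec_mxK); apply/matrixP => j l; rewrite [RHS]mxE [RHS]mxE.
rewrite vec_mx_real_point; case: ifP => // _.
case: (unlift ord_max j) => [i|] /=; rewrite ?mxE profile0 // expr0n /= ?mulr0 //.
by case: k k_gt2 => // k' _; rewrite mul0r.
Qed.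

(** Along a sequence of the horn rescaled by r, the last coordinate is
    r c^2 up to sign and the others are at most r c^2 * c^(k-2); the factor
    c^(k-2) tends to 0 since k > 2. *)
Lemma horn_tangent_cone : half_line (tangent_cone0 (horn @` @cylinder R p)).
Proof.
have k2 : (2 + (k - 2))%N = k by rewrite subnKC // ltnW.
have k2_neq0 : (k - 2 == 0)%N = false by rewrite subn_eq0 leqNgt k_gt2.
exists (real_point 0 sg).
  apply/eqP => /(congr1 (fun v => re_w v)); rewrite re_w_real_point /re_w !mxE => sg0.
  by move: sg2; rewrite sg0 expr0n /= => /esym/eqP; rewrite oner_eq0.
apply/seteqP; split=> [w [x [r [xA r0 x0 rx]]]|w [s s0 <-]].
  pose tu m := s2val (cid2 (xA m)).
  have tuP m : @cylinder R p (tu m) /\ horn (tu m) = x m.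
    by rewrite /tu; case: cid2.
  pose c m := profile k (tu m).1.
  have xE m : x m = horn (tu m) by have [_ ->] := tuP m.
  have xj j l : vec_mx (x m) j l @[m --> \oo] --> (0 : R).
    have -> : 0 = vec_mx (0 : 'rV[R]_(p.+2 * 2)) j l by rewrite !mxE.
    exact: (cvg_comp _ _ x0 (@coord_vec_mx_continuous R p.+1 j l 0)).
  have rxj j l : r m * vec_mx (x m) j l @[m --> \oo] --> vec_mx w j l.
    have := cvg_comp _ _ rx (@coord_vec_mx_continuous R p.+1 j l w).
    by apply: cvg_trans; apply: near_eq_cvg; near=> m; rewrite /= linearZ mxE.
  have sgc2 : (fun m => c m ^+ 2) = fun m => sg * vec_mx (x m) ord_max 0.
    by apply/funext => m; rewrite xE vec_mx_horn_max mulrA -[sg * sg]expr2 sg2 mul1r.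
  have c0 : c m @[m --> \oo] --> (0 : R).
    have -> : c = fun m => Num.sqrt (c m ^+ 2).
      by apply/funext => m; rewrite sqrtr_sqr ger0_norm // profile_ge0.
    have c20 : c m ^+ 2 @[m --> \oo] --> (0 : R).
      by rewrite sgc2 -[0 in X in _ --> X](mulr0 sg); apply: cvgMr; apply: xj.
    by have := cvg_comp _ _ c20 (@sqrt_continuous R 0); rewrite sqrtr0.
  have rc2 : r m * c m ^+ 2 @[m --> \oo] --> sg * re_w w.
    have -> : (fun m => r m * c m ^+ 2) = fun m => sg * (r m * vec_mx (x m) ord_max 0).
      by apply/funext => m; have /(congr1 (fun f => f m)) /= -> := sgc2; rewrite mulrCA.
    by apply: cvgMr; apply: rxj.
  exists (sg * re_w w).
    by apply: (cvgr_to_ge rc2); near=> m; rewrite mulr_ge0 ?exprn_ge0 ?profile_ge0 ?ltW.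
  have wj j : vec_mx w (lift ord_max j) 0 = 0.
    apply: (@cvg_unique _ _ _ _ _ _ (rxj (lift ord_max j) 0)) => //=.
    have b0 : r m * c m ^+ 2 * c m ^+ (k - 2) @[m --> \oo] --> (0 : R).
      rewrite -[0 in X in _ --> X](mulr0 (sg * re_w w)); apply: cvgM => //.
      have := cvg_comp _ _ c0 (@exprn_continuous R (k - 2) 0).
      by rewrite expr0n k2_neq0.
    have b0N : - (r m * c m ^+ 2 * c m ^+ (k - 2)) @[m --> \oo] --> (0 : R).
      by rewrite -[0 in X in _ --> X]oppr0; apply: cvgN.
    apply: squeeze_cvgr b0N b0; near=> m.
    rewrite -ler_norml xE vec_mx_horn_lift -mulrA -exprD k2 normrM gtr0_norm //.
    rewrite ler_wpM2l ?(ltW (r0 m)) // normrM ger0_norm ?exprn_ge0 ?profile_ge0 //.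
    rewrite ler_piMr ?exprn_ge0 ?profile_ge0 // sphere_coord_le1 //.
    by have [[_ ?] _] := tuP m.
  have wim j l : l != 0 -> vec_mx w j l = 0.
    move=> l0; apply: (@cvg_unique _ _ _ _ _ _ (rxj j l)) => //=.
    under eq_fun do rewrite xE vec_mx_horn_im // mulr0; exact: cvg_cst.
  apply: (can_inj vec_mxK); apply/matrixP => j l.
  rewrite linearZ mxE vec_mx_real_point.
  case: ifPn => [/eqP -> |/wim->]; last by rewrite mulr0.
  case: (unliftP ord_max j) => [i ->|->] /=; first by rewrite mxE mulr0 wj.
  by rewrite mulrAC -[sg * sg]expr2 sg2 mul1r.
(* Conversely, the ray is the limit of rescaled points of a single generator. *)
have pole_in t : 0 <= t <= 1 -> @cylinder R p (t, pole).
  by move=> t01; split; [rewrite /= in_itv|exact: pole_sphere].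
have [->|s_neq0] := eqVneq s 0.
  exists (fun=> 0), (fun=> 1); split=> //; last 2 first.
  - exact: cvg_cst.
  - by under eq_fun do rewrite scaler0; rewrite scale0r; exact: cvg_cst.
  move=> m; exists (0, pole); last exact: horn_origin.
  by apply: pole_in; rewrite lexx ler01.
have s_gt0 : 0 < s by rewrite lt_def s_neq0.
pose t m : R := harmonic m.
have t0 m : 0 < t m by apply: harmonic_gt0.
have c0 m : 0 < profile k (t m) by apply: profile_gt0.
have tc : t @ \oo --> (0 : R) by apply: cvg_harmonic.
exists (fun m => horn (t m, pole)), (fun m => s / profile k (t m) ^+ 2); split.
- move=> m; exists (t m, pole) => //; apply: pole_in.
  by rewrite ltW //= /t /= invf_le1 ?ler1n ?ltr0n.
- by move=> m; rewrite divr_gt0 // exprn_gt0.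
- rewrite -(horn_origin pole); apply: (cvg_comp (fun m => (t m, pole)) horn).
    exact: cvg_pair tc (cvg_cst _).
  exact: horn_map_continuous.
have pc : profile k (t m) @[m --> \oo] --> (0 : R).
  by have := cvg_comp _ _ tc (@profile_continuous R k k_gt2 0); rewrite profile0.
apply: cvg_vec_mx => j l; under eq_fun do rewrite linearZ mxE.
rewrite linearZ mxE vec_mx_real_point; case: ifPn => [/eqP -> |l0]; last first.
  by under eq_fun do rewrite vec_mx_horn_im // mulr0; rewrite mulr0; exact: cvg_cst.
case: (unliftP ord_max j) => [i ->|->] /=.
  have -> : (fun m =>
      s / profile k (t m) ^+ 2 * vec_mx (horn (t m, pole)) (lift ord_max i) 0) =
      fun m => s * profile k (t m) ^+ (k - 2) * pole 0 i.
    apply/funext => m; rewrite vec_mx_horn_lift /=; have := c0 m.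
    move: (profile k (t m)) => c cp.
    have -> : c ^+ k = c ^+ 2 * c ^+ (k - 2) by rewrite -exprD k2.
    by field; rewrite gt_eqF.
  rewrite mxE mulr0 -(mul0r (pole 0 i)); apply: cvgMl.
  rewrite -(mulr0 s); apply: cvgMr.
  have := cvg_comp _ _ pc (@exprn_continuous R (k - 2) 0).
  by rewrite expr0n k2_neq0.
have -> : (fun m => s / profile k (t m) ^+ 2 * vec_mx (horn (t m, pole)) ord_max 0) =
    fun=> s * sg; last exact: cvg_cst.
by apply/funext => m; rewrite vec_mx_horn_max /=; field; rewrite gt_eqF.
Unshelve. all: by end_near. Qed.

(** A real point (x, y) of the hypersurface with sg * y >= 0 is the image of
    (t, x / c^k), where c = sqrt (sg * y) and t is the norm of the point, unless
    c = 0, in which case the point is the origin. *)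
Lemma horn_germ :
  germ_eq (horn @` @cylinder R p)
    (hypersurface k `&` @real_points R p.+1 `&` [set v | 0 <= sg * re_w v]).
Proof.
have : \forall v \near (0 : 'rV[R]_(p.+2 * 2)), enorm v < 1.
  have := @enorm_continuous R (p.+2 * 2) 0; move/cvgr_lt; apply.
  by rewrite -(scale0r 0) enormZ normr0 mul0r.
apply: filterS => v v1; split.
  move=> [tu [t01 u1] <-]; have /andP[t0 _] : 0 <= tu.1 <= 1 by move: t01; rewrite /= in_itv.
  have [] := horn_in_link (n := p.+1) k_gt2 sg2 sgk t0 u1.
  split; first by split=> //; apply: real_points_real_point.
  rewrite /= re_w_real_point mulrA -[sg * sg]expr2 sg2 mul1r.
  exact: exprn_ge0 (profile_ge0 k_gt2 _).
move=> [[Xv rv] yv].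
have vE := real_point_of rv; set x := \row_j _ in vE; set y := re_w v in vE yv.
have xy : enorm x ^+ 2 = y ^+ k by apply/hypersurface_real_point; rewrite -vE.
have vv : enorm v ^+ 2 = enorm x ^+ 2 + y ^+ 2 by rewrite vE enorm_sqr_real_point.
pose c := Num.sqrt (sg * y).
have c0 : 0 <= c by apply: sqrtr_ge0.
have c2 : c ^+ 2 = sg * y by rewrite sqr_sqrtr.
have yE : y = sg * c ^+ 2 by rewrite c2 mulrA -[sg * sg]expr2 sg2 mul1r.
have cx : enorm x ^+ 2 = (c ^+ k) ^+ 2.
  by rewrite xy yE exprMn sgk mul1r -!exprM mulnC.
have cp : profile k (enorm v) = c.
  apply: profile_uniq => //; rewrite vv cx yE exprMn sg2 mul1r /radius_poly.
  by rewrite -!exprM addrC (mulnC k).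
have v01 : 0 <= enorm v <= 1 by rewrite enorm_ge0 ltW.
have [c_eq0|c_neq0] := eqVneq c 0.
  exists (0, pole); first by split; [rewrite /= in_itv /= lexx ler01|exact: pole_sphere].
  rewrite horn_origin; apply/esym; apply: enorm_eq0; apply/eqP.
  rewrite -sqrf_eq0 vv cx yE c_eq0.
  rewrite !expr0n /=; case: k k_gt2 => // k' _ /=.
  by rewrite !expr0n mulr0 expr0n addr0.
exists (enorm v, (c ^+ k)^-1 *: x).
  split; first by rewrite /= in_itv.
  rewrite /sphere /= enormZ normfV ger0_norm ?exprn_ge0 //.
  have -> : enorm x = c ^+ k.
    by apply/eqP; rewrite -(@eqrXn2 _ 2) ?enorm_ge0 ?exprn_ge0 // cx.
  by rewrite mulVf // expf_neq0.
rewrite /horn /= cp scalerA mulfV ?expf_neq0 // scale1r [RHS]vE.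
by congr real_point; rewrite yE.
Qed.

End HornMap.

(** * Polynomial functions and subanalytic sets *)
Lemma continuous_fin_prod (R : realType) (T : topologicalType) (I : Type)
    (r : seq I) (f : I -> T -> R) :
  (forall i, continuous (f i)) -> continuous (fun x => \prod_(i <- r) f i x).
Proof.
move=> cf; elim: r => [|i r IHr].
  by under eq_fun do rewrite big_nil; exact: cst_continuous.
under eq_fun do rewrite big_cons.
by move=> x; exact: cvgM (cf i x) (IHr x).
Qed.

Section PolynomialFunctions.
Variable (R : realType).

Definition monomial m (a : 'rV[R]_m) (q : R * {ffun 'I_m -> nat}) (x : 'rV[R]_m) : R :=
  q.1 * \prod_i (x 0 i - a 0 i) ^+ q.2 i.

(** Polynomial functions, presented by their expansions around all centres: the
    finite power series that analyticity at a point asks for. *)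
Definition polyfun m (f : 'rV[R]_m -> R) : Prop :=
  forall a, exists s, forall x, f x = \sum_(q <- s) monomial a q x.

Section Closure.
Variable m : nat.
Implicit Types f g : 'rV[R]_m -> R.

Lemma polyfun_cst c : polyfun (fun _ : 'rV[R]_m => c).
Proof.
move=> a; exists [:: (c, [ffun=> 0%N])] => x; rewrite big_seq1 /monomial /=.
by rewrite big1 ?mulr1 // => i _; rewrite ffunE.
Qed.

Lemma polyfun_coord i : polyfun (fun x : 'rV[R]_m => x 0 i).
Proof.
move=> a; exists [:: (a 0 i, [ffun=> 0%N]); (1, [ffun j => nat_of_bool (j == i)])] => x.
rewrite big_cons big_seq1 /monomial /= big1 ?mulr1 => [|j _]; last by rewrite ffunE.
rewrite mul1r (bigD1 i) //= ffunE eqxx expr1 big1 ?mulr1 => [|j /negPf ji].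
  by rewrite addrC subrK.
by rewrite ffunE ji.
Qed.

Lemma polyfunD f g : polyfun f -> polyfun g -> polyfun (fun x => f x + g x).
Proof.
move=> pf pg a; have [s fs] := pf a; have [t gt] := pg a.
by exists (s ++ t) => x; rewrite big_cat fs gt.
Qed.

Lemma polyfunM f g : polyfun f -> polyfun g -> polyfun (fun x => f x * g x).
Proof.
move=> pf pg a; have [s fs] := pf a; have [t gt] := pg a.
pose mul (q r : R * {ffun 'I_m -> nat}) : R * {ffun 'I_m -> nat} :=
  (q.1 * r.1, [ffun i => (q.2 i + r.2 i)%N]).
exists [seq mul q r | q <- s, r <- t] => x.
rewrite big_allpairs_dep /= fs gt big_distrl; apply: eq_bigr => q _ /=.
rewrite big_distrr; apply: eq_bigr => r _; rewrite /monomial /= mulrACA.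
congr (_ * _); rewrite -big_split; apply: eq_bigr => i _ /=.
by rewrite ffunE exprD.
Qed.

Lemma polyfunB f g : polyfun f -> polyfun g -> polyfun (fun x => f x - g x).
Proof.
move=> pf pg; under eq_fun do rewrite -[g _]mul1r -mulNr.
by apply: polyfunD => //; apply: polyfunM => //; apply: polyfun_cst.
Qed.

Lemma polyfunX f k : polyfun f -> polyfun (fun x => f x ^+ k).
Proof.
move=> pf; elim: k => [|k IHk]; first exact: polyfun_cst.
by under eq_fun do rewrite exprS; apply: polyfunM.
Qed.

Lemma polyfun_sum (I : Type) (r : seq I) (f : I -> 'rV[R]_m -> R) :
  (forall i, polyfun (f i)) -> polyfun (fun x => \sum_(i <- r) f i x).
Proof.
move=> pf; elim: r => [|i r IHr].
  by under eq_fun do rewrite big_nil; apply: polyfun_cst.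
by under eq_fun do rewrite big_cons; apply: polyfunD.
Qed.

Lemma polyfun_prod (I : Type) (r : seq I) (f : I -> 'rV[R]_m -> R) :
  (forall i, polyfun (f i)) -> polyfun (fun x => \prod_(i <- r) f i x).
Proof.
move=> pf; elim: r => [|i r IHr].
  by under eq_fun do rewrite big_nil; apply: polyfun_cst.
by under eq_fun do rewrite big_cons; apply: polyfunM.
Qed.

Lemma polyfun_continuous f : polyfun f -> continuous f.
Proof.
move=> /(_ 0)[s fs].
rewrite (_ : f = fun x => \sum_(q <- s) monomial 0 q x); last exact/funext.
apply: continuous_fin_sum => q x.
suff : {for x, continuous (monomial 0 q)} by [].
apply: continuousM; first exact: cst_continuous.
apply: continuous_fin_prod => i y.
suff : {for y, continuous (fun x : 'rV[R]_m => (x 0 i - (0 : 'rV[R]_m) 0 i) ^+ q.2 i)} by [].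
apply: continuous_exprn; apply: continuousB; [exact: coord_continuous|exact: cst_continuous].
Qed.

(** The partial sums over boxes are constant once the box contains all
    exponents of the expansion. *)
Lemma polyfun_analytic f a : polyfun f -> analytic_at f a.
Proof.
move=> /(_ a)[s fs].
exists (fun e => \sum_(q <- s | q.2 == e) q.1), (\sum_(q <- s) `|q.1|), 1; split=> //.
  move=> e; rewrite expr1n mulr1; apply: le_trans (ler_norm_sum _ _ _) _.
  rewrite big_mkcond; apply: ler_sum => q _; case: ifP => // _; exact: normr_ge0.
move=> x _.
(* Boxes of side larger than D contain every exponent, each exactly once. *)
pose D := \max_(q <- s) \max_i q.2 i.
have expD q i : q \in s -> (q.2 i <= D)%N.
  move=> qs; apply: (@leq_trans (\max_i q.2 i)); first exact: leq_bigmax.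
  by rewrite /D (big_rem q) //= leq_maxl.
apply: cvg_near_cst; near=> K.
have DK : (D < K)%N by near: K; exists D.+1.
move: (K) DK => [//|K']; rewrite ltnS => DK.
rewrite fs.
transitivity (\sum_(q <- s)
  \sum_(e : {ffun 'I_m -> 'I_K'.+1} | q.2 == [ffun i => e i : nat]) monomial a q x).
  rewrite (exchange_big_dep xpredT) //=; apply: eq_bigr => e _.
  rewrite mulr_suml; apply: eq_bigr => q /eqP qe; congr (_ * _).
  by apply: eq_bigr => i _; rewrite qe ffunE.
rewrite big_seq [RHS]big_seq; apply: eq_bigr => q qs.
rewrite (big_pred1 [ffun i => inord (q.2 i)]) // => e.
have inK i : (q.2 i < K'.+1)%N by rewrite ltnS (leq_trans (expD q i qs)).
apply/eqP/eqP => [qe|->].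
  by apply/ffunP => i; rewrite ffunE qe ffunE; apply/val_inj; rewrite /= inordK.
by apply/ffunP => i; rewrite !ffunE inordK.
Unshelve. all: by end_near. Qed.

End Closure.

Lemma semianalytic_poly m (f g : 'rV[R]_m -> R) :
  polyfun f -> polyfun g -> semianalytic [set x | f x = 0 /\ 0 < g x].
Proof.
move=> pf pg a; exists setT; first by split; [exact: openT|].
exists 1%N, 2, (fun _ j => if j == ord0 then f else g), (fun _ j => j == ord0).
split=> [i j x _|x _].
  by apply: polyfun_analytic; case: ifP.
split=> [[f0 g0]|[_ fg]]; first by exists ord0 => j; case: (j == ord0).
by split; [exact: (fg ord0)|exact: (fg (lift ord0 ord0))].
Qed.

Lemma compact_closure_bounded m (B : set 'rV[R]_m) M :
  (forall x, B x -> forall i, `|x 0 i| <= M) -> compact (closure B).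
Proof.
move=> BM; have K : compact [set x : 'rV[R]_m | forall i, x 0 i \in `[- M, M]].
  by apply: (@rV_compact _ _ (fun=> `[- M, M]%classic)) => i; apply: segment_compact.
apply: (subclosed_compact _ K); first exact: closed_closure.
have /closure_id -> := compact_closed (@norm_hausdorff _ _) K.
by apply: closure_subset => x Bx i; rewrite in_itv /= -ler_norml BM.
Qed.

(** One equation is enough, since over an ordered field several amount to the
    vanishing of a sum of squares. *)
Definition algebraic m (A : set 'rV[R]_m) : Prop :=
  exists2 f, polyfun f & A = [set x | f x = 0].

Lemma algebraic_eq m (f g : 'rV[R]_m -> R) :
  polyfun f -> polyfun g -> algebraic [set x | f x = g x].
Proof.
move=> pf pg; exists (fun x => f x - g x); first exact: polyfunB.
by apply/seteqP; split=> x /= => [->|/eqP]; rewrite ?subrr // subr_eq0 => /eqP.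
Qed.

Lemma algebraicI m (A B : set 'rV[R]_m) : algebraic A -> algebraic B -> algebraic (A `&` B).
Proof.
move=> [f pf ->] [g pg ->]; exists (fun x => f x ^+ 2 + g x ^+ 2).
  by apply: polyfunD; apply: polyfunX.
apply/seteqP; split=> x /= => [[-> ->]|/eqP]; first by rewrite expr0n addr0.
by rewrite paddr_eq0 ?sqr_ge0 // !sqrf_eq0 => /andP[/eqP ? /eqP ?].
Qed.

Lemma algebraic_forall m (I : finType) (A : I -> set 'rV[R]_m) :
  (forall i, algebraic (A i)) -> algebraic [set x | forall i, A i x].
Proof.
move=> algA.
pose f i := s2val (cid2 (algA i)).
have pf i : polyfun (f i) by rewrite /f; case: cid2.
have Af i : A i = [set x | f i x = 0] by rewrite /f; case: cid2.
exists (fun x => \sum_i f i x ^+ 2).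
  by apply: polyfun_sum => i; apply: polyfunX.
apply/seteqP; split=> x /= => [Ax|/eqP].
  by rewrite big1 // => i _; have := Ax i; rewrite Af /= => ->; rewrite expr0n.
rewrite psumr_eq0 => [/allP H i|i _]; last exact: sqr_ge0.
by rewrite Af /=; have := H i; rewrite mem_index_enum /= sqrf_eq0 => /(_ isT)/eqP.
Qed.

Lemma polyfun_comp m q (f : 'rV[R]_m -> R) (L : 'rV[R]_q -> 'rV[R]_m) :
  polyfun f -> (forall i, polyfun (fun w => L w 0 i)) -> polyfun (fun w => f (L w)).
Proof.
move=> /(_ 0)[s fs] pL; under eq_fun do rewrite fs.
apply: polyfun_sum => r; apply: polyfunM; first exact: polyfun_cst.
apply: polyfun_prod => i; apply: polyfunX; apply: polyfunB => //; exact: polyfun_cst.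
Qed.

Lemma polyfun_lsubmx m q (f : 'rV[R]_m -> R) :
  polyfun f -> polyfun (fun w : 'rV[R]_(m + q) => f (lsubmx w)).
Proof.
move=> pf; apply: polyfun_comp => // i; under eq_fun do rewrite mxE.
exact: polyfun_coord.
Qed.

(** Only boundedness has to be ensured, which the polynomial inequality of a
    ball around the given point does. *)
Lemma algebraic_subanalytic m (A : set 'rV[R]_m) : algebraic A -> subanalytic A.
Proof.
move=> [f pf ->] a.
pose g (x : 'rV[R]_m) := 1 - \sum_i (x 0 i - a 0 i) ^+ 2.
have pg : polyfun g.
  apply: polyfunB; first exact: polyfun_cst.
  apply: polyfun_sum => i; apply: polyfunX.
  by apply: polyfunB; [exact: polyfun_coord|exact: polyfun_cst].
exists [set x | 0 < g x].
  split.
    have /continuousP := polyfun_continuous pg.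
    by move=> /(_ [set r | 0 < r]); apply; exact: open_gt.
  by rewrite /= /g big1 ?subr0 // => i _; rewrite subrr expr0n.
exists 0%N, [set w : 'rV[R]_(m + 0) | f (lsubmx w) = 0 /\ 0 < g (lsubmx w)]; split.
- by apply: semianalytic_poly; apply: polyfun_lsubmx.
- apply: (@compact_closure_bounded _ _ (1 + \sum_i `|a 0 i|)) => w [_ gw] i.
  case: (splitP i) => [j ij|[]//].
  have -> : w 0 i = lsubmx w 0 j by rewrite mxE; congr (w 0 _); apply/val_inj.
  move: gw; rewrite /g subr_gt0 (bigD1 j) //= => gw.
  have dw : `|lsubmx w 0 j - a 0 j| < 1.
    rewrite -(@ltr_pXn2r _ 2) ?nnegrE // real_normK ?num_real // expr1n.
    by apply: le_lt_trans gw; rewrite lerDl sumr_ge0 // => l _; apply: sqr_ge0.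
  rewrite -(subrK (a 0 j) (lsubmx w 0 j)); apply: le_trans (ler_normD _ _) _.
  apply: lerD; first exact: ltW.
  by rewrite (bigD1 j) //= lerDl; apply: sumr_ge0.
apply/seteqP; split=> [x [fx gx]|_ [w [fw gw] <-]] //.
by exists (row_mx x (0 : 'rV[R]_0)); rewrite /= ?row_mxKl.
Qed.

Lemma projection_subanalytic m q (B : set 'rV[R]_(m + q)) M :
  algebraic B -> (forall x, B x -> forall i, `|x 0 i| <= M) ->
  subanalytic (lsubmx @` B).
Proof.
move=> [f pf Bf] BM a; exists setT; first by split; [exact: openT|].
exists q, B; split; last by rewrite setIT.
  have -> : B = [set x | f x = 0 /\ 0 < (1 : R)].
    by rewrite Bf; apply/seteqP; split=> x //= [].
  by apply: semianalytic_poly => //; apply: polyfun_cst.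
exact: compact_closure_bounded BM.
Qed.

End PolynomialFunctions.

(** * The choking horns of the hypersurface *)
Section SubanalyticHorn.
Variables (R : realType) (p k : nat) (sg : R).
Hypotheses (k_gt2 : (2 < k)%N) (sg2 : sg ^+ 2 = 1) (sgk : sg ^+ k = 1).

Definition cpolyfun m (F : 'rV[R]_m -> R[i]) : Prop :=
  polyfun (fun x => complex.Re (F x)) /\ polyfun (fun x => complex.Im (F x)).

Lemma ReIm_mul (x y : R[i]) :
  complex.Re (x * y) = complex.Re x * complex.Re y - complex.Im x * complex.Im y /\
  complex.Im (x * y) = complex.Re x * complex.Im y + complex.Im x * complex.Re y.
Proof. by case: x y => [a b] [c d] /=; split=> //; rewrite [b * c]mulrC. Qed.

Lemma cpolyfunX m (F : 'rV[R]_m -> R[i]) l : cpolyfun F -> cpolyfun (fun x => F x ^+ l).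
Proof.
move=> [pr pi]; elim: l => [|l [IHr IHi]].
  by split; [exact: (polyfun_cst 1)|exact: (polyfun_cst 0)].
split.
  under eq_fun do rewrite exprS (ReIm_mul _ _).1.
  by apply: polyfunB; apply: polyfunM.
under eq_fun do rewrite exprS (ReIm_mul _ _).2.
by apply: polyfunD; apply: polyfunM.
Qed.

Lemma cpolyfun_sum m (I : Type) (r : seq I) (F : I -> 'rV[R]_m -> R[i]) :
  (forall i, cpolyfun (F i)) -> cpolyfun (fun x => \sum_(i <- r) F i x).
Proof.
move=> pF.
have ReE x : complex.Re (\sum_(i <- r) F i x) = \sum_(i <- r) complex.Re (F i x).
  by apply: (big_morph (@complex.Re R)) => // [[a b] [c d]].
have ImE x : complex.Im (\sum_(i <- r) F i x) = \sum_(i <- r) complex.Im (F i x).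
  by apply: (big_morph (@complex.Im R)) => // [[a b] [c d]].
split; [under eq_fun do rewrite ReE|under eq_fun do rewrite ImE];
  by apply: polyfun_sum => i; have [] := pF i.
Qed.

Lemma polyfun_vec_mx n q (L : 'rV[R]_q -> 'rV[R]_(n.+1 * 2)) j l :
    (forall i, polyfun (fun w => L w 0 i)) ->
  polyfun (fun w => vec_mx (L w) j l).
Proof. by move=> pL; under eq_fun do rewrite mxE; apply: pL. Qed.

Lemma hypersurface_algebraic n : algebraic (@hypersurface R n k).
Proof.
have cc j : cpolyfun (fun v : 'rV[R]_(n.+1 * 2) => ccoord v j).
  by split; apply: polyfun_vec_mx => i; apply: polyfun_coord.
have [pr pi] : cpolyfun (fun v : 'rV[R]_(n.+1 * 2) => \sum_j ccoord v (lift ord_max j) ^+ 2).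
  by apply: cpolyfun_sum => j; apply: cpolyfunX.
have [qr qi] := cpolyfunX k (cc ord_max).
have -> : @hypersurface R n k =
    [set v | complex.Re (\sum_j ccoord v (lift ord_max j) ^+ 2) =
             complex.Re (ccoord v ord_max ^+ k)] `&`
    [set v | complex.Im (\sum_j ccoord v (lift ord_max j) ^+ 2) =
             complex.Im (ccoord v ord_max ^+ k)].
  apply/seteqP; split=> [v /hypersurfaceE Xv|v [re im]].
    by split; rewrite /= Xv.
  by apply/hypersurfaceE/eqP; rewrite eq_complex re im !eqxx.
by apply: algebraicI; apply: algebraic_eq.
Qed.

Notation N := (p.+2 * 2)%N.
Notation lifted_space := 'rV[R]_(1 + (p.+1 + N) + 3).

Let time (w : lifted_space) : R := lsubmx (lsubmx w) 0 0.
Let direction (w : lifted_space) : 'rV[R]_p.+1 := lsubmx (rsubmx (lsubmx w)).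
Let point (w : lifted_space) : 'rV[R]_N := rsubmx (rsubmx (lsubmx w)).
Let aux (w : lifted_space) (i : 'I_3) : R := rsubmx w 0 i.

Let i0 : 'I_3 := ord0.
Let i1 : 'I_3 := lift ord0 ord0.
Let i2 : 'I_3 := ord_max.

(** The graph of the horn with three more coordinates a, b, d, whose squares are
    t, 1 - t and c.  They replace the inequalities 0 <= t <= 1 and c >= 0, so
    that polynomial equations suffice. *)
Definition lifted_graph : set lifted_space :=
  [set w | time w = aux w i0 ^+ 2] `&` [set w | 1 - time w = aux w i1 ^+ 2] `&`
  [set w | radius_poly k (aux w i2 ^+ 2) = time w ^+ 2] `&`
  [set w | \sum_j direction w 0 j ^+ 2 = 1] `&`
  [set w | forall j, vec_mx (point w) (lift ord_max j) 0 =
                     (aux w i2 ^+ 2) ^+ k * direction w 0 j] `&`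
  [set w | vec_mx (point w) ord_max 0 = sg * (aux w i2 ^+ 2) ^+ 2] `&`
  [set w | forall j, vec_mx (point w) j 1 = 0].

Lemma lifted_graph_algebraic : algebraic lifted_graph.
Proof.
have pt : polyfun time.
  by rewrite /time; under eq_fun do rewrite !mxE; exact: polyfun_coord.
have pd j : polyfun (fun w => direction w 0 j).
  by rewrite /direction; under eq_fun do rewrite !mxE; exact: polyfun_coord.
have pp j l : polyfun (fun w => vec_mx (point w) j l).
  apply: polyfun_vec_mx => i; rewrite /point; under eq_fun do rewrite !mxE.
  exact: polyfun_coord.
have pa i : polyfun (fun w => aux w i).
  by rewrite /aux; under eq_fun do rewrite !mxE; exact: polyfun_coord.
rewrite /lifted_graph; repeat apply: algebraicI.
- by apply: algebraic_eq => //; apply: polyfunX.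
- by apply: algebraic_eq; [apply: polyfunB => //; apply: polyfun_cst|apply: polyfunX].
- apply: algebraic_eq; last exact: polyfunX.
  by apply: polyfunD; do 2!apply: polyfunX.
- apply: algebraic_eq; last exact: polyfun_cst.
  by apply: polyfun_sum => j; apply: polyfunX.
- apply: algebraic_forall => j; apply: algebraic_eq => //.
  by apply: polyfunM => //; do 2!apply: polyfunX.
- apply: algebraic_eq => //; apply: polyfunM; first exact: polyfun_cst.
  by do 2!apply: polyfunX.
- by apply: algebraic_forall => j; apply: algebraic_eq => //; apply: polyfun_cst.
Qed.

Lemma lifted_graphP w : lifted_graph w ->
  [/\ 0 <= time w <= 1, @sphere R p (direction w),
      point w = @horn R p.+1 k sg (time w, direction w) & forall i, `|aux w i| <= 1].
Proof.
move=> [[[[[[ta tb] tc] u1] vj] vmax] vim].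
rewrite /= in ta tb tc u1 vj vmax vim.
have t0 : 0 <= time w by rewrite ta sqr_ge0.
have t1 : time w <= 1 by rewrite -subr_ge0 tb sqr_ge0.
have c0 : 0 <= aux w i2 ^+ 2 by apply: sqr_ge0.
have cp := profile_uniq k_gt2 c0 tc.
have S : @sphere R p (direction w).
  by apply/eqP; rewrite /= -(@eqrXn2 _ 2) ?enorm_ge0 // enorm_sqr u1 expr1n.
split=> //; first by rewrite t0.
  apply: (can_inj vec_mxK); apply/matrixP => j l.
  rewrite [RHS]vec_mx_real_point; case: ifPn => [/eqP ->|l0].
    case: (unliftP ord_max j) => [i ->|->] /=; first by rewrite vj [RHS]mxE cp.
    by rewrite vmax cp.
  by rewrite -(vim j); congr (vec_mx _ j _); case: l l0 => -[|[|//]] // i _; apply/val_inj.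
move=> i; rewrite -(@ler_pXn2r _ 2) ?nnegrE // expr1n real_normK ?num_real //.
have : [\/ i = i0, i = i1 | i = i2].
  by case: i => -[|[|[|//]]] h; [constructor 1|constructor 2|constructor 3]; apply/val_inj.
case=> ->; first by rewrite -ta.
  by rewrite -tb lerBlDr lerDl.
by rewrite -cp profile_le1 ?t0.
Qed.

Lemma lifted_graph_bounded w : lifted_graph w -> forall i, `|w 0 i| <= 1.
Proof.
move=> /lifted_graphP[/andP[t0 t1] S v a1].
have split_bound q r (x : 'rV[R]_(q + r)) :
    (forall i, `|lsubmx x 0 i| <= 1) -> (forall i, `|rsubmx x 0 i| <= 1) ->
    forall i, `|x 0 i| <= 1.
  move=> xl xr i; case: (split_ordP i) => j ->.
    by have := xl j; rewrite mxE.
  by have := xr j; rewrite mxE.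
apply: (split_bound _ _ w) => [|//].
apply: (split_bound _ _ (lsubmx w)) => [i|].
  by rewrite (ord1 i) -/(time w) ger0_norm.
apply: (split_bound _ _ (rsubmx (lsubmx w))) => [j|]; first exact: sphere_coord_le1.
move=> i; rewrite -/(point w) v; case/mxvec_indexP: i => j l.
have -> : horn k sg (time w, direction w) 0 (mxvec_index j l) =
    vec_mx (horn k sg (time w, direction w)) j l by rewrite [RHS]mxE.
apply: le_trans (vec_mx_le_enorm _ _ _) _.
by have [_ ->] := horn_in_link (n := p.+1) (tu := (time w, direction w)) k_gt2 sg2 sgk t0 S.
Qed.

Lemma horn_graph : graph (@horn R p.+1 k sg) = lsubmx @` lifted_graph.
Proof.
apply/seteqP; split=> [_ [[t u] [t01 u1] <-]|_ [w Bw <-]].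
  have /andP[t0 t1] : 0 <= t <= 1 by move: t01; rewrite /= in_itv.
  pose e : 'rV[R]_3 :=
    \row_i nth 0 [:: Num.sqrt t; Num.sqrt (1 - t); Num.sqrt (profile k t)] i.
  pose w : lifted_space := row_mx (row_mx t%:M (row_mx u (horn k sg (t, u)))) e.
  exists w; last by rewrite row_mxKl.
  have tE : time w = t by rewrite /time /w !row_mxKl mxE eqxx mulr1n.
  have uE : direction w = u by rewrite /direction /w row_mxKl row_mxKr row_mxKl.
  have vE : point w = horn k sg (t, u) by rewrite /point /w row_mxKl !row_mxKr.
  have aE : aux w i0 ^+ 2 = t by rewrite /aux /w row_mxKr mxE sqr_sqrtr.
  have bE : aux w i1 ^+ 2 = 1 - t by rewrite /aux /w row_mxKr mxE sqr_sqrtr ?subr_ge0.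
  have cE : aux w i2 ^+ 2 = profile k t by rewrite /aux /w row_mxKr mxE sqr_sqrtr ?profile_ge0.
  rewrite /lifted_graph /setI /= tE uE vE aE bE cE radius_poly_profile //.
  rewrite -enorm_sqr u1 expr1n vec_mx_horn_max.
  split; last by move=> j; rewrite vec_mx_horn_im.
  by split=> //; split; [do 3![split=> //]|move=> j; rewrite vec_mx_horn_lift].
have [t01 S v _] := lifted_graphP Bw.
exists (time w, direction w); first by split=> //=; rewrite in_itv.
rewrite -v /= -[RHS]hsubmxK; congr row_mx; last by rewrite hsubmxK.
by rewrite [RHS]mx11_scalar.
Qed.

Lemma horn_graph_subanalytic : subanalytic (graph (@horn R p.+1 k sg)).
Proof.
rewrite horn_graph; apply: projection_subanalytic lifted_graph_bounded.
exact: lifted_graph_algebraic.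
Qed.

End SubanalyticHorn.

(** The sign -1 is available when k is even, and gives the lower half-horn. *)
Lemma signed_choking_horn (R : realType) (p k : nat) (sg : R) :
    (2 < k)%N -> sg ^+ 2 = 1 -> sg ^+ k = 1 ->
  choking_horn (@hypersurface R p.+2 k) (inner_dist (@hypersurface R p.+2 k))
    (@hypersurface R p.+2 k `&` @real_points R p.+2 `&` [set v | 0 <= sg * re_w v]).
Proof.
move=> k_gt2 sg2 sgk; split.
- by apply: hypersurface_connected; apply: leq_trans k_gt2.
- exact/algebraic_subanalytic/hypersurface_algebraic.
exists p, (@horn R p.+2 k sg); split.
- split.
  + exact/continuous_subspaceT/horn_map_continuous.
  + exact: horn_graph_subanalytic.
  + move=> tu [t01 u1]; apply: horn_in_link => //.
    by move: t01; rewrite /= in_itv => /andP[].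
  + exact: horn_tangent_cone.
- exact: horn_germ.
- exact: horn_chokes.
Qed.

Theorem theorem3p1 (R : realType) (n k : nat) (hn : (1 < n)%N) (hk : (2 < k)%N) :
  let X := @hypersurface R n k in
  let Y := X `&` @real_points R n in
  [/\ Y = @real_embedding R n @` @real_hypersurface R n k,
      odd k -> choking_horn X (inner_dist X) Y &
      ~~ odd k ->
        choking_horn X (inner_dist X) (Y `&` [set v | 0 <= re_w v]) /\
        choking_horn X (inner_dist X) (Y `&` [set v | re_w v <= 0])].
Proof.
move=> X Y; split; first exact: real_part_hypersurface.
  case: n hn @X @Y => [|[|p]] // _ X Y k_odd.
  have := @signed_choking_horn R p k 1 hk (expr1n _ _) (expr1n _ _).
  suff -> : Y `&` [set v | 0 <= 1 * re_w v] = Y by [].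
  apply/seteqP; split=> [v []//|v [Xv rv]]; split=> //=.
  rewrite mul1r; move: Xv; rewrite {1}(real_point_of rv) => /hypersurface_real_point yk.
  rewrite leNgt; apply/negP => y0.
  have := sqr_ge0 (enorm (\row_j vec_mx v (lift ord_max j) 0)).
  by rewrite yk leNgt exprn_odd_lt0 // y0.
case: n hn @X @Y => [|[|p]] // _ X Y k_even; split.
  have := @signed_choking_horn R p k 1 hk (expr1n _ _) (expr1n _ _).
  by have -> : [set v : 'rV[R]_(p.+3 * 2) | 0 <= 1 * re_w v] = [set v | 0 <= re_w v];
    first by apply/funext => v; rewrite /= mul1r.
have sqrN1 : (- 1 : R) ^+ 2 = 1 by rewrite sqrrN expr1n.
have := @signed_choking_horn R p k (- 1) hk sqrN1 _.
have -> : [set v : 'rV[R]_(p.+3 * 2) | 0 <= -1 * re_w v] = [set v | re_w v <= 0].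
  by apply/funext => v; rewrite /= mulN1r oppr_ge0.
by apply; rewrite -signr_odd (negPf k_even).
Qed.
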